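(* Let $\nu$ and $a$ be real numbers with $\nu>-\frac{3}{4}$ and $a\geq\frac{2}{4\nu+3}$, and let $w_{a,\nu}:\mathbb{D}\to\mathbb{C}$ be defined by $$w_{a,\nu}(z)=\frac{2^{\nu}}{a}\Gamma(\nu+1)z^{1-\frac{\nu}{2}}\left((a-\nu)J_{\nu}(\sqrt{z})+\sqrt{z}J_{\nu}'(\sqrt{z})\right)=\sum_{n\geq0}\frac{(-1)^n(2n+a)\Gamma(\nu+1)z^{n+1}}{a\cdot 4^n\,n!\,\Gamma(n+\nu+1)}.$$ The function $w_{a,\nu}$ is starlike in $\mathbb{D}$ and all of its derivatives $w_{a,\nu}^{(k)}$, $k\geq1$, are close-to-convex (and hence univalent) in $\mathbb{D}$ if and only if $\nu\geq\nu_a$, where $\nu_a$ is the unique root of the equation $$(2a-1)J_{\nu}(1)-(a-2\nu+2)J_{\nu+1}(1)=0$$ (in the unknown $\nu$, for the given $a$) on $\left(-\frac{3}{4},\infty\right)$.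
   Context: $\mathbb{D}=\{z\in\mathbb{C}:|z|<1\}$ is the open unit disk. $J_\nu$ is the Bessel function of the first kind of order $\nu$, $J_\nu(z)=\sum_{n\ge0}\frac{(-1)^n}{n!\,\Gamma(\nu+n+1)}\left(\frac z2\right)^{2n+\nu}$, and $J_\nu'$ is its derivative with respect to $z$. The expression with $\sqrt z$ and $z^{1-\nu/2}$ is understood as the single-valued function given by the displayed power series (which is entire). Starlike means univalent on $\mathbb{D}$ with image starlike with respect to the origin. An analytic function $g$ on $\mathbb{D}$ (no normalization required) is close-to-convex if there is a convex univalent function $h$ on $\mathbb{D}$ (not necessarily normalized) with $\operatorname{Re}(g'(z)/h'(z))>0$ for all $z\in\mathbb{D}$. *)

(* Defs.v *)
From Stdlib Require Import Reals Factorial.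
From Coquelicot Require Import Coquelicot.
Open Scope R_scope.

(* Euler's integral; it converges for x > 0, and only such x occur below. *)
Definition Gamma (x : R) : R :=
  RInt_gen (fun t => Rpower t (x - 1) * exp (- t)) (at_right 0) (Rbar_locally p_infty).

(* Bessel function of the first kind of real order nu > -1 at a real x > 0
   (Rpower is the real power of a positive base). *)
Definition BesselJ (nu x : R) : R :=
  Series (fun n => (-1) ^ n / (INR (fact n) * Gamma (nu + INR n + 1))
                   * Rpower (x / 2) (2 * INR n + nu)).

Definition w_coef (a nu : R) (n : nat) : R :=
  (-1) ^ n * (2 * INR n + a) * Gamma (nu + 1)
  / (a * 4 ^ n * INR (fact n) * Gamma (INR n + nu + 1)).

(* Sum of a complex series, componentwise. *)
Definition CSeries (u : nat -> C) : C :=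
  (Series (fun n => Re (u n)), Series (fun n => Im (u n))).

(* The entire function whose restriction to (0, oo) is
     2^nu / a * Gamma (nu + 1) * x^(1 - nu/2)
       * ((a - nu) * J_nu (sqrt x) + sqrt x * J_nu' (sqrt x)). *)
Definition w (a nu : R) (z : C) : C :=
  CSeries (fun n => RtoC (w_coef a nu n) * z ^ S n)%C.

(* Functions on the open unit disk are represented by total functions C -> C;
   only their values on the disk matter. *)
Definition disk (z : C) : Prop := Cmod z < 1.

Definition disk_image (f : C -> C) (p : C) : Prop :=
  exists z : C, disk z /\ f z = p.

Definition analytic_disk (f : C -> C) : Prop :=
  forall z : C, disk z -> @ex_derive C_AbsRing C_NormedModule f z.

Definition univalent (f : C -> C) : Prop :=
  analytic_disk f /\
  forall z1 z2 : C, disk z1 -> disk z2 -> f z1 = f z2 -> z1 = z2.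

Definition starlike_set (S : C -> Prop) : Prop :=
  forall (p : C) (t : R), S p -> 0 <= t <= 1 -> S (RtoC t * p)%C.

Definition convex_set (S : C -> Prop) : Prop :=
  forall (p q : C) (t : R), S p -> S q -> 0 <= t <= 1 ->
    S (RtoC (1 - t) * p + RtoC t * q)%C.

Definition starlike (f : C -> C) : Prop :=
  univalent f /\ starlike_set (disk_image f).

Definition convex_univalent (h : C -> C) : Prop :=
  univalent h /\ convex_set (disk_image h).

(* C_derive is a total operator that agrees with the complex derivative wherever the
   latter exists, hence for g and h on the disk.
   Since x / 0 = 0 in C, the strict inequality forces h' <> 0 on the disk. *)
Definition close_to_convex (g : C -> C) : Prop :=
  analytic_disk g /\
  exists h : C -> C, convex_univalent h /\
    forall z : C, disk z -> 0 < Re (C_derive g z / C_derive h z)%C.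

Definition C_derive_n (f : C -> C) (k : nat) : C -> C := Nat.iter k C_derive f.

Definition nu_equation (a mu : R) : Prop :=
  (2 * a - 1) * BesselJ mu 1 - (a - 2 * mu + 2) * BesselJ (mu + 1) 1 = 0.

(* Main.v *)
Require Import Defs.
From Stdlib Require Import Reals.
From Coquelicot Require Import Coquelicot.
From Stdlib Require Import Lra Lia Factorial FunctionalExtensionality.
Open Scope R_scope.

(** Write [w = z phi]. Two facts about [w] carry the theorem, and they are of very
    different depth.

    The derivatives are easy. For every [nu > -3/4] the Taylor coefficients of
    [w^(k+1)], [k >= 1], decrease so fast that the constant term exceeds the
    sum of the absolute values of all others ([dominant_w_derive_coef]). Hence
    [w^(k+1) / c] has positive real part on the disk for [c = w^(k+1)(0)], so
    [w^(k)] is univalent and close-to-convex with comparison function [c z].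
    Consequently the condition on [nu] concerns starlikeness alone. The case
    [k = 1] also shows that [w'] decreases strictly on the unit interval.

    Starlikeness is equivalent to [w'(1) >= 0]. If [w'(1) < 0], then [w'] vanishes
    inside (0, 1), where [w] turns back and is not injective
    ([univalent_w_real']). For the converse consider [s = - z phi' / phi], so that
    [z w' / w = 1 - s]. The function [phi] has only positive zeros [z_n], whence
    [s = sum z / (z_n - z)] has nonnegative coefficients; this can be proved
    without zeros. The normalized Bessel function [psi] satisfies a second order
    equation, so [v = - z psi' / psi] satisfies a Riccati equation
    [z v' + nu v = z / 4 + v^2], from which the coefficients of [v] are positive by
    recursion ([bessel_riccati], [bessel_logder_bounds]). Since
    [phi = psi (1 - b v)] with [b = 2 / a], one gets [s = v + b z v' / (1 - b v)],
    again with nonnegative coefficients ([theta_w_coef], [w_logder_bounds]), and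
    the hypothesis [a >= 2 / (4 nu + 3)] makes the series converge on the disk.
    On the real axis [phi (1 - s) = w' > 0], so [s (rho) < 1] for [0 < rho < 1],
    and by positivity [|s| <= s (rho) < 1] on the whole disk of radius [rho].

    Passing from this bound to starlikeness uses logarithms: [w = z exp (- L)] with
    [z L' = s] ([CP_mul_cexp]), so in the coordinate [x = log z] the function
    [log w] becomes [x - L (e^x)], and [L (e^x)] is a contraction on the half plane
    [Re x <= ln rho] with constant [s (rho)] ([CP_cexp_contraction]). The identity
    minus a contraction is injective, and the value [log w(z) + ln t] is reached
    by Banach's fixed point theorem ([starlike_of_contraction]).

    Finally, by Bessel's equation the left-hand side of the equation for [nu_a]
    is a positive multiple of [w'(1)] ([nu_equation_iff]). As a function of
    [nu], [w'(1)] is an alternating series that is strictly increasing and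
    Lipschitz ([w_real'_1_increment]), negative at -7/10 and
    positive for large [nu]; so the root exists, is unique, and [w'(1) >= 0] means
    [nu_a <= nu]. *)

(** * Euler's integral *)

Definition Gamma_integrand (x t : R) : R := Rpower t (x - 1) * exp (- t).

(** The proper integrals increase with the interval, so they converge to their
    supremum, which in particular bounds each of them. *)
Lemma is_RInt_gen_bounded_nonneg (f : R -> R) (M : R) :
  (forall t, 0 < t -> continuous f t) ->
  (forall t, 0 < t -> 0 <= f t) ->
  (forall a b, 0 < a -> a <= b -> RInt f a b <= M) ->
  exists l, is_RInt_gen f (at_right 0) (Rbar_locally p_infty) l /\
    forall a b, 0 < a -> a <= b -> RInt f a b <= l.
Proof.
intros Hc Hp HM.
assert (Hex : forall a b, 0 < a -> a <= b -> ex_RInt f a b).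
{ intros a b Ha Hab. apply (ex_RInt_continuous (V := R_CompleteNormedModule)).
  rewrite Rmin_left, Rmax_right by lra. intros z Hz. apply Hc; lra. }
set (E := fun y => exists a b, 0 < a /\ a <= b /\ y = RInt f a b).
destruct (completeness E) as [l [Hub Hlub]].
{ exists M. intros y (a & b & Ha & Hb & ->). now apply HM. }
{ exists (RInt f 1 1), 1, 1; repeat split; lra. }
exists l; split.
2: { intros a b Ha Hb. apply Hub. exists a, b; auto. }
intros P [eps HP].
assert (exists y, E y /\ l - eps < y) as [y [(a0 & b0 & Ha0 & Hb0 & ->) Hy]].
{ apply Classical_Prop.NNPP. intro HN.
  assert (l <= l - eps); [|destruct eps; simpl in *; lra].
  apply Hlub. intros y Hy. apply Rnot_lt_le. intro. apply HN; exists y; auto. }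
exists (fun a => 0 < a < a0) (fun b => b0 < b).
{ exists (mkposreal a0 Ha0). intros u Hu Hu0. apply Rabs_def2 in Hu.
  unfold minus, plus, opp in Hu; simpl in Hu. lra. }
{ exists b0; auto. }
intros a b Ha Hb. exists (RInt f a b). split; simpl.
{ apply (RInt_correct (V := R_CompleteNormedModule)), Hex; lra. }
apply HP. unfold ball; simpl; unfold AbsRing_ball, abs, minus, plus, opp; simpl.
assert (H1 : RInt f a b <= l) by (apply Hub; exists a, b; repeat split; lra).
assert (H2 : RInt f a0 b0 <= RInt f a b).
{ rewrite <- (RInt_Chasles f a a0 b), <- (RInt_Chasles f a0 b0 b) by (apply Hex; lra).
  unfold plus; simpl.
  assert (0 <= RInt f a a0).
  { apply RInt_ge_0; [lra|apply Hex; lra|]. intros t Ht; apply Hp; lra. }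
  assert (0 <= RInt f b0 b).
  { apply RInt_ge_0; [lra|apply Hex; lra|]. intros t Ht; apply Hp; lra. }
  lra. }
apply Rabs_def1; lra.
Qed.

(** This is [ln s <= s - 1] at [s = t / (2 x)]. *)
Lemma Rpower_le_exp_half (x : R) : 0 < x ->
  exists K, 0 < K /\ forall t, 0 < t -> Rpower t x <= K * exp (t / 2).
Proof.
intros Hx. exists (exp (x * ln (2 * x) - x)). split; [apply exp_pos|].
intros t Ht. unfold Rpower. rewrite <- exp_plus.
assert (Hl : ln (t / (2 * x)) <= t / (2 * x) - 1).
{ assert (0 < t / (2 * x)) by (apply Rdiv_lt_0_compat; lra).
  pose proof (exp_ineq1_le (ln (t / (2 * x)))) as H1. rewrite exp_ln in H1 by assumption. lra. }
rewrite ln_div in Hl by lra.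
assert (Hm := Rmult_le_compat_l x _ _ (Rlt_le _ _ Hx) Hl).
replace (x * (t / (2 * x) - 1)) with (t / 2 - x) in Hm by (field; lra).
destruct (Rle_lt_or_eq_dec (x * ln t) (x * ln (2 * x) - x + t / 2)) as [H|H]; [lra| |].
- left; now apply exp_increasing.
- rewrite H; lra.
Qed.

Lemma is_derive_Rpower (y t : R) : 0 < t ->
  is_derive (fun s => Rpower s y) t (y * Rpower t (y - 1)).
Proof.
intros Ht. rewrite is_derive_Reals. apply derivable_pt_lim_power; assumption.
Qed.

Lemma continuous_Gamma_integrand x t : 0 < t -> continuous (Gamma_integrand x) t.
Proof.
intros Ht. apply (ex_derive_continuous (K := R_AbsRing) (V := R_NormedModule)).
eexists. apply (is_derive_mult (fun t => Rpower t (x - 1)) (fun t => exp (- t))).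
- now apply is_derive_Rpower.
- auto_derive; [trivial|reflexivity].
- intros; apply Rmult_comm.
Qed.

Lemma Gamma_integrand_pos x t : 0 < Gamma_integrand x t.
Proof. apply Rmult_lt_0_compat; apply exp_pos. Qed.

(** The integrand is at most a multiple of the derivative of the bounded
    function [t^x / (1 + t^x)], which settles both endpoints at once. *)
Lemma RInt_Gamma_integrand_bounded x : 0 < x ->
  exists M, forall a b, 0 < a -> a <= b -> RInt (Gamma_integrand x) a b <= M.
Proof.
intros Hx. destruct (Rpower_le_exp_half x Hx) as (K & HK0 & HK).
exists ((1 + K) ^ 2 / x). intros a b Ha Hab.
set (G := fun t => (1 + K) ^ 2 / x * (Rpower t x / (1 + Rpower t x))).
set (dG := fun t => (1 + K) ^ 2 * Rpower t (x - 1) / (1 + Rpower t x) ^ 2).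
assert (Hpos : forall t, 0 < Rpower t x) by (intro; apply exp_pos).
assert (HG : is_RInt dG a b (minus (G b) (G a))).
{ apply (is_RInt_derive G dG); rewrite Rmin_left, Rmax_right by lra; intros t Ht.
  - unfold G, dG. evar_last.
    { apply (is_derive_scal (fun t => Rpower t x / (1 + Rpower t x))).
      apply (is_derive_div (fun t => Rpower t x) (fun t => 1 + Rpower t x)).
      + apply is_derive_Rpower; lra.
      + apply (is_derive_plus (fun _ => 1) (fun t => Rpower t x)); [apply is_derive_const|].
        apply is_derive_Rpower; lra.
      + specialize (Hpos t); lra. }
    unfold plus, zero; simpl. specialize (Hpos t). field. split; lra.
  - apply (ex_derive_continuous (K := R_AbsRing) (V := R_NormedModule)). unfold dG. eexists.
    apply (is_derive_div (fun t => (1 + K) ^ 2 * Rpower t (x - 1)) (fun t => (1 + Rpower t x) ^ 2)).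
    + apply (is_derive_scal (fun t => Rpower t (x - 1))), is_derive_Rpower; lra.
    + apply (is_derive_pow (fun t => 1 + Rpower t x)).
      apply (is_derive_plus (fun _ => 1) (fun t => Rpower t x)); [apply is_derive_const|].
      apply is_derive_Rpower; lra.
    + apply pow_nonzero. specialize (Hpos t); lra. }
apply Rle_trans with (RInt dG a b).
- apply RInt_le; [assumption| |eexists; exact HG|].
  + apply (ex_RInt_continuous (V := R_CompleteNormedModule)).
    rewrite Rmin_left, Rmax_right by lra. intros z Hz. apply continuous_Gamma_integrand; lra.
  + intros t Ht. unfold dG, Gamma_integrand.
    assert (He : 1 <= exp (t / 2)) by (pose proof (exp_ineq1_le (t / 2)); lra).
    assert (H1 : 0 < 1 + Rpower t x <= (1 + K) * exp (t / 2)).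
    { specialize (HK t ltac:(lra)). specialize (Hpos t). split; [lra|]. nra. }
    assert (H2 : (1 + Rpower t x) ^ 2 <= (1 + K) ^ 2 * exp t).
    { replace (exp t) with (exp (t / 2) ^ 2).
      - rewrite <- Rpow_mult_distr. apply pow_incr. lra.
      - simpl. rewrite Rmult_1_r, <- exp_plus. f_equal; lra. }
    unfold Rdiv. rewrite (Rmult_comm ((1 + K) ^ 2)), Rmult_assoc.
    apply Rmult_le_compat_l; [left; apply exp_pos|].
    apply Rmult_le_reg_r with ((1 + Rpower t x) ^ 2); [apply pow_lt; lra|].
    rewrite Rmult_assoc, Rinv_l, Rmult_1_r by (apply pow_nonzero; lra).
    rewrite exp_Ropp. apply Rmult_le_reg_l with (exp t); [apply exp_pos|].
    rewrite <- Rmult_assoc, Rinv_r by (apply Rgt_not_eq, exp_pos). lra.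
- rewrite (is_RInt_unique _ _ _ _ HG). unfold minus, plus, opp, G; simpl.
  assert (Hr : forall t, 0 < Rpower t x / (1 + Rpower t x) < 1).
  { intro t. specialize (Hpos t). split; [apply Rdiv_lt_0_compat; lra|].
    apply Rlt_div_l; lra. }
  pose proof (Hr a); pose proof (Hr b).
  assert (0 < (1 + K) ^ 2 / x) by (apply Rdiv_lt_0_compat; [apply pow_lt|]; lra).
  simpl in *. nra.
Qed.

(** [RInt_gen] has a meaningful value only once convergence is known. *)
Lemma Gamma_spec x : 0 < x ->
  is_RInt_gen (Gamma_integrand x) (at_right 0) (Rbar_locally p_infty) (Gamma x) /\
  0 < Gamma x.
Proof.
intros Hx. destruct (RInt_Gamma_integrand_bounded x Hx) as [M HM].
destruct (is_RInt_gen_bounded_nonneg (Gamma_integrand x) M) as (l & Hl & Hle).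
- intros; now apply continuous_Gamma_integrand.
- intros; left; apply Gamma_integrand_pos.
- exact HM.
- replace (Gamma x) with l; [split; [assumption|]|].
  + apply Rlt_le_trans with (RInt (Gamma_integrand x) 1 2); [|apply Hle; lra].
    apply RInt_gt_0; [lra|intros; apply Gamma_integrand_pos|].
    intros; apply continuous_Gamma_integrand; lra.
  + change (Gamma x) with (RInt_gen (V := R_CompleteNormedModule) (Gamma_integrand x)
      (at_right 0) (Rbar_locally p_infty)).
    symmetry. apply (is_RInt_gen_unique (V := R_CompleteNormedModule)); exact Hl.
Qed.

Lemma Gamma_pos x : 0 < x -> 0 < Gamma x.
Proof. intros; now apply Gamma_spec. Qed.

(** Integration by parts: [t^x e^(-t)] tends to 0 at both ends. *)
Lemma Gamma_succ x : 0 < x -> Gamma (x + 1) = x * Gamma x.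
Proof.
intros Hx.
set (f := fun t => Rpower t x * exp (- t)).
assert (Hd : forall t, 0 < t ->
  is_derive f t (x * Gamma_integrand x t - Gamma_integrand (x + 1) t)).
{ intros t Ht. unfold f, Gamma_integrand. evar_last.
  { apply (is_derive_mult (fun t => Rpower t x) (fun t => exp (- t))).
    - now apply is_derive_Rpower.
    - auto_derive; [trivial|reflexivity].
    - intros; apply Rmult_comm. }
  unfold plus, mult; simpl. replace (x + 1 - 1) with x by lra. ring. }
destruct (Gamma_spec x Hx) as [I1 _]. destruct (Gamma_spec (x + 1)) as [I2 _]; [lra|].
assert (I3 := is_RInt_gen_minus _ _ _ _ (is_RInt_gen_scal _ x _ I1) I2).
assert (I4 : is_RInt_gen (Derive f) (at_right 0) (Rbar_locally p_infty) (0 - 0)).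
{ apply is_RInt_gen_Derive.
  - exists (fun a => 0 < a) (fun b => 0 < b).
    + exists (mkposreal 1 Rlt_0_1); auto.
    + now exists 0.
    + intros a b Ha Hb t Ht. simpl in Ht.
      assert (0 < t) by (apply Rlt_le_trans with (Rmin a b); [now apply Rmin_pos|lra]).
      eexists; now apply Hd.
  - exists (fun a => 0 < a) (fun b => 0 < b).
    + exists (mkposreal 1 Rlt_0_1); auto.
    + now exists 0.
    + intros a b Ha Hb t Ht. simpl in Ht.
      assert (Ht0 : 0 < t) by (apply Rlt_le_trans with (Rmin a b); [now apply Rmin_pos|lra]).
      apply continuous_ext_loc with (fun t => x * Gamma_integrand x t - Gamma_integrand (x + 1) t).
      * exists (mkposreal t Ht0). intros u Hu. symmetry. apply is_derive_unique, Hd.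
        apply Rabs_def2 in Hu. unfold minus, plus, opp in Hu; simpl in Hu. lra.
      * apply (continuous_minus (V := R_NormedModule)).
        -- apply (continuous_scal_r x (Gamma_integrand x)). now apply continuous_Gamma_integrand.
        -- now apply continuous_Gamma_integrand.
  - apply filterlim_locally. intros eps.
    assert (He := cond_pos eps).
    exists (mkposreal (exp (ln eps / x)) (exp_pos _)). intros t Ht Ht0.
    apply Rabs_def2 in Ht. unfold minus, plus, opp in Ht; simpl in Ht.
    assert (Hlt : Rpower t x < eps).
    { unfold Rpower. rewrite <- (exp_ln eps) by assumption. apply exp_increasing.
      apply Rmult_lt_reg_r with (/ x); [now apply Rinv_0_lt_compat|].
      rewrite (Rmult_comm x), Rmult_assoc, Rinv_r, Rmult_1_r by lra.
      apply exp_lt_inv. rewrite exp_ln by assumption. unfold Rdiv in Ht. lra. }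
    assert (exp (- t) < 1) by (rewrite <- exp_0; apply exp_increasing; lra).
    assert (0 < Rpower t x) by apply exp_pos. assert (0 < exp (- t)) by apply exp_pos.
    unfold f, ball; simpl; unfold AbsRing_ball, abs, minus, plus, opp; simpl.
    rewrite Ropp_0, Rplus_0_r, Rabs_right; nra.
  - destruct (Rpower_le_exp_half x Hx) as (K & HK0 & HK).
    apply filterlim_locally. intros eps.
    assert (He := cond_pos eps).
    exists (Rmax 1 (- 2 * ln (eps / K))). intros t Ht.
    assert (Ht0 := Rle_lt_trans _ _ _ (Rmax_l _ _) Ht).
    assert (Ht1 := Rle_lt_trans _ _ _ (Rmax_r _ _) Ht).
    assert (Hlt : K * exp (- (t / 2)) < eps).
    { apply Rmult_lt_reg_l with (/ K); [now apply Rinv_0_lt_compat|].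
      rewrite <- Rmult_assoc, Rinv_l, Rmult_1_l by lra.
      rewrite (Rmult_comm (/ K)). fold (eps / K).
      rewrite <- (exp_ln (eps / K)) by (apply Rdiv_lt_0_compat; lra).
      apply exp_increasing. lra. }
    unfold f, ball; simpl; unfold AbsRing_ball, abs, minus, plus, opp; simpl.
    assert (0 < Rpower t x) by apply exp_pos.
    rewrite Ropp_0, Rplus_0_r, Rabs_right by (assert (0 < exp (- t)) by apply exp_pos; nra).
    apply Rle_lt_trans with (2 := Hlt).
    replace (K * exp (- (t / 2))) with (K * exp (t / 2) * exp (- t)).
    + apply Rmult_le_compat_r; [left; apply exp_pos|]. apply HK; lra.
    + rewrite Rmult_assoc, <- exp_plus. do 2 f_equal. lra. }
assert (I5 : is_RInt_gen (Derive f) (at_right 0) (Rbar_locally p_infty)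
   (minus (scal x (Gamma x)) (Gamma (x + 1)))).
{ refine (is_RInt_gen_ext _ _ _ _ I3).
  exists (fun a => 0 < a) (fun b => 0 < b).
  - exists (mkposreal 1 Rlt_0_1); auto.
  - now exists 0.
  - intros a b Ha Hb t Ht. simpl in Ht. symmetry. apply is_derive_unique, Hd.
    apply Rlt_trans with (Rmin a b); [now apply Rmin_pos|lra]. }
assert (H1 := is_RInt_gen_unique (V := R_CompleteNormedModule) _ _ I4).
assert (H2 := is_RInt_gen_unique (V := R_CompleteNormedModule) _ _ I5).
rewrite H1 in H2. unfold minus, plus, opp, scal in H2; simpl in H2.
unfold mult in H2; simpl in H2. lra.
Qed.

(** * Complex power series with real coefficients *)

Lemma C_eq (x y : C) : Re x = Re y -> Im x = Im y -> x = y.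
Proof. destruct x, y; simpl; intros; subst; reflexivity. Qed.

Lemma Series_zero (u : nat -> R) : (forall n, u n = 0) -> Series u = 0.
Proof.
intro H. rewrite (Series_ext u (fun n => 0 * u n)) by (intro n; rewrite H; ring).
rewrite Series_scal_l. ring.
Qed.

Lemma ex_series_le_R (u v : nat -> R) :
  (forall n, Rabs (u n) <= v n) -> ex_series v -> ex_series u.
Proof. intros H Hv. exact (ex_series_le (V := R_CompleteNormedModule) u v H Hv). Qed.

Lemma ex_series_scal_R (c : R) (u : nat -> R) :
  ex_series u -> ex_series (fun n => c * u n).
Proof. exact (ex_series_scal (V := R_NormedModule) c u). Qed.

Lemma ex_series_ext_R (u v : nat -> R) :
  (forall n, u n = v n) -> ex_series u -> ex_series v.
Proof. exact (ex_series_ext (V := R_NormedModule) u v). Qed.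

Definition C_abs_summable (u : nat -> C) : Prop := ex_series (fun n => Cmod (u n)).

Lemma Rabs_Im_le_Cmod (z : C) : Rabs (Im z) <= Cmod z.
Proof. apply Rle_trans with (2 := Rmax_Cmod z). apply Rmax_r. Qed.

Lemma ex_series_Re u : C_abs_summable u -> ex_series (fun n => Rabs (Re (u n))).
Proof.
intro H. apply (ex_series_le (V := R_CompleteNormedModule)) with (2 := H).
intro n. unfold norm; simpl. unfold abs; simpl. rewrite Rabs_Rabsolu. apply re_le_Cmod.
Qed.

Lemma ex_series_Im u : C_abs_summable u -> ex_series (fun n => Rabs (Im (u n))).
Proof.
intro H. apply (ex_series_le (V := R_CompleteNormedModule)) with (2 := H).
intro n. unfold norm; simpl. unfold abs; simpl. rewrite Rabs_Rabsolu. apply Rabs_Im_le_Cmod.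
Qed.

Lemma CSeries_ext u v : (forall n, u n = v n) -> CSeries u = CSeries v.
Proof.
intro H. unfold CSeries. f_equal; apply Series_ext; intro n; now rewrite H.
Qed.

Lemma CSeries_incr_1 u : u 0%nat = RtoC 0 -> CSeries u = CSeries (fun n => u (S n)).
Proof.
intro H. unfold CSeries. f_equal; apply Series_incr_1_aux; now rewrite H.
Qed.

Lemma CSeries_plus u v : C_abs_summable u -> C_abs_summable v ->
  CSeries (fun n => u n + v n)%C = (CSeries u + CSeries v)%C.
Proof.
intros Hu Hv. unfold CSeries. apply C_eq; simpl; rewrite <- Series_plus;
  try reflexivity; apply ex_series_Rabs; auto using ex_series_Re, ex_series_Im.
Qed.

Lemma CSeries_scal (c : C) u : C_abs_summable u ->
  CSeries (fun n => c * u n)%C = (c * CSeries u)%C.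
Proof.
intros Hu.
assert (ex_series (fun n => Re (u n))) by now apply ex_series_Rabs, ex_series_Re.
assert (ex_series (fun n => Im (u n))) by now apply ex_series_Rabs, ex_series_Im.
apply C_eq; simpl.
- rewrite <- !Series_scal_l, <- Series_minus; try reflexivity;
    now apply (ex_series_scal (V := R_NormedModule)).
- rewrite <- !Series_scal_l, <- Series_plus; try reflexivity;
    now apply (ex_series_scal (V := R_NormedModule)).
Qed.

(** Pairing the sum [s] with its own conjugate reduces the triangle inequality
    to real series: [|s|^2 = sum Re (conj s * u n) <= |s| * sum |u n|]. *)
Lemma Cmod_CSeries_le u : C_abs_summable u ->
  Cmod (CSeries u) <= Series (fun n => Cmod (u n)).
Proof.
intros Hu. set (s := CSeries u).
destruct (Req_dec (Cmod s) 0) as [H0|H0].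
{ rewrite H0. rewrite <- (Series_zero (fun _ => 0)) by reflexivity.
  apply Series_le; [|exact Hu]. intro; split; [lra|apply Cmod_ge_0]. }
assert (Hs : 0 < Cmod s) by (pose proof (Cmod_ge_0 s); lra).
apply Rmult_le_reg_l with (Cmod s); [exact Hs|].
rewrite <- Series_scal_l.
replace (Cmod s * Cmod s) with (Re (CSeries (fun n => Cconj s * u n)%C)).
- unfold CSeries; simpl.
  assert (He : ex_series (fun n => Cmod s * Cmod (u n)))
    by now apply (ex_series_scal (V := R_NormedModule)).
  assert (Hb : forall n, Rabs (Re (Cconj s * u n)%C) <= Cmod s * Cmod (u n)).
  { intro n. rewrite <- (Cmod_conj s), <- Cmod_mult. apply re_le_Cmod. }
  assert (Ha : ex_series (fun n => Rabs (Re (Cconj s * u n)%C))).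
  { apply (ex_series_le (V := R_CompleteNormedModule)) with (2 := He).
    intro n. unfold norm; simpl. unfold abs; simpl. rewrite Rabs_Rabsolu. apply Hb. }
  apply Rle_trans with (1 := Rle_abs _), Rle_trans with (1 := Series_Rabs _ Ha).
  apply Series_le; [|exact He]. intro n; split; [apply Rabs_pos|apply Hb].
- rewrite CSeries_scal by exact Hu. fold s.
  replace (Cmod s * Cmod s) with (Cmod s ^ 2) by ring. rewrite Cmod2_alt.
  destruct s; simpl; ring.
Qed.

Definition abs_summable (a : nat -> R) (r : R) : Prop :=
  ex_series (fun n => Rabs (a n) * r ^ n).

Definition CP (a : nat -> R) (z : C) : C := CSeries (fun n => RtoC (a n) * z ^ n)%C.

Lemma Cmod_term (x : R) (z : C) (n : nat) :
  Cmod (RtoC x * z ^ n)%C = Rabs x * Cmod z ^ n.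
Proof. now rewrite Cmod_mult, Cmod_R, Cmod_pow. Qed.

Lemma C_abs_summable_term a z : abs_summable a (Cmod z) ->
  C_abs_summable (fun n => RtoC (a n) * z ^ n)%C.
Proof. intro H. refine (ex_series_ext_R _ _ _ H). intro n. now rewrite Cmod_term. Qed.

Lemma abs_summable_le a b r : 0 <= r -> (forall n, Rabs (a n) <= Rabs (b n)) ->
  abs_summable b r -> abs_summable a r.
Proof.
intros Hr H Hb. apply ex_series_le_R with (2 := Hb). intro n.
assert (0 <= r ^ n) by now apply pow_le.
rewrite Rabs_mult, Rabs_Rabsolu, (Rabs_right (r ^ n)) by lra.
now apply Rmult_le_compat_r.
Qed.

Lemma abs_summable_le_r a r1 r2 : 0 <= r1 <= r2 -> abs_summable a r2 -> abs_summable a r1.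
Proof.
intros Hr H. apply ex_series_le_R with (2 := H). intro n.
rewrite Rabs_mult, Rabs_Rabsolu.
assert (0 <= r1 ^ n) by (apply pow_le; lra). rewrite (Rabs_right (r1 ^ n)) by lra.
apply Rmult_le_compat_l; [apply Rabs_pos|]. now apply pow_incr.
Qed.

Lemma Cmod_CP_le a z r : Cmod z <= r -> abs_summable a r ->
  Cmod (CP a z) <= Series (fun n => Rabs (a n) * r ^ n).
Proof.
intros Hz Ha. pose proof (Cmod_ge_0 z).
assert (Hs := abs_summable_le_r a (Cmod z) r ltac:(lra) Ha).
apply Rle_trans with (1 := Cmod_CSeries_le _ (C_abs_summable_term _ _ Hs)).
apply Series_le; [|exact Ha]. intro n. split; [apply Cmod_ge_0|].
rewrite Cmod_term. apply Rmult_le_compat_l; [apply Rabs_pos|]. now apply pow_incr.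
Qed.

Lemma CP_real a x : CP a (RtoC x) = RtoC (PSeries a x).
Proof.
unfold CP, PSeries.
assert (Hp : forall n, (RtoC x ^ n)%C = RtoC (x ^ n)).
{ induction n as [|n IH]; simpl; [reflexivity|]. now rewrite IH, RtoC_mult. }
apply C_eq; simpl.
- apply Series_ext. intro n. rewrite Hp. simpl. ring.
- apply Series_zero. intro n. rewrite Hp. simpl. ring.
Qed.

Lemma Cmod_pow_sub_le (z1 z2 : C) (r : R) (n : nat) : Cmod z1 <= r -> Cmod z2 <= r ->
  Cmod (z1 ^ S n - z2 ^ S n)%C <= INR (S n) * r ^ n * Cmod (z1 - z2)%C.
Proof.
intros H1 H2. induction n as [|n IH].
{ simpl. replace (z1 * 1 - z2 * 1)%C with (z1 - z2)%C by ring. lra. }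
replace (z1 ^ S (S n) - z2 ^ S (S n))%C
  with (z1 * (z1 ^ S n - z2 ^ S n) + z2 ^ S n * (z1 - z2))%C
  by (simpl; ring).
apply Rle_trans with (1 := Cmod_triangle _ _). rewrite !Cmod_mult, Cmod_pow.
pose proof (Cmod_ge_0 z1) as P1. pose proof (Cmod_ge_0 z2) as P2.
pose proof (Cmod_ge_0 (z1 - z2)%C) as P3.
assert (Hr : 0 <= r ^ n) by (apply pow_le; lra).
assert (Hp : Cmod z2 ^ S n <= r ^ S n) by now apply pow_incr.
apply Rle_trans with (r * (INR (S n) * r ^ n * Cmod (z1 - z2)%C) + r ^ S n * Cmod (z1 - z2)%C).
- apply Rplus_le_compat; [|now apply Rmult_le_compat_r].
  apply Rmult_le_compat; auto. apply Cmod_ge_0.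
- rewrite (S_INR (S n)). simpl (r ^ S n). right; ring.
Qed.

(** Euler's operator [z d/dz] on coefficient sequences. *)
Definition theta (a : nat -> R) (n : nat) : R := INR n * a n.

Lemma CP_minus_eq a z1 z2 : abs_summable a (Cmod z1) -> abs_summable a (Cmod z2) ->
  (CP a z1 - CP a z2)%C = CSeries (fun n => RtoC (a n) * (z1 ^ n - z2 ^ n))%C.
Proof.
intros H1 H2. apply C_abs_summable_term in H1. apply C_abs_summable_term in H2.
unfold CP. replace (CSeries (fun n => RtoC (a n) * z2 ^ n)%C)
  with (- (CSeries (fun n => (-(1)) * (RtoC (a n) * z2 ^ n))%C))%C.
- replace (- CSeries (fun n => -(1) * (RtoC (a n) * z2 ^ n)))%C
   with (-(1) * CSeries (fun n => -(1) * (RtoC (a n) * z2 ^ n)))%C by ring.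
  rewrite CSeries_scal by exact H2.
  replace (CSeries (fun n => RtoC (a n) * z1 ^ n) - -(1) * (-(1) * CSeries (fun n => RtoC (a n) * z2 ^ n)))%C
   with (CSeries (fun n => RtoC (a n) * z1 ^ n) + (-(1) * CSeries (fun n => RtoC (a n) * z2 ^ n)))%C by ring.
  rewrite <- CSeries_scal by exact H2. rewrite <- CSeries_plus.
  + apply CSeries_ext. intro n; ring.
  + exact H1.
  + refine (ex_series_ext_R _ _ _ H2). intro n. rewrite <- (Cmod_opp (RtoC (a n) * z2 ^ n)%C). f_equal. ring.
- rewrite CSeries_scal by exact H2. ring.
Qed.

(** Termwise, [|z1^n - z2^n| <= n r^(n-1) |z1 - z2|]: a power series that starts
    at degree 1 is Lipschitz with the constant read off its derivative. *)
Lemma CP_lipschitz a z1 z2 r : 0 < r -> Cmod z1 <= r -> Cmod z2 <= r ->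
  abs_summable a r -> abs_summable (theta a) r ->
  Cmod (CP a z1 - CP a z2)%C <=
  Series (fun n => Rabs (theta a n) * r ^ n) * (Cmod (z1 - z2)%C / r).
Proof.
intros Hr H1 H2 Ha Hd.
pose proof (Cmod_ge_0 z1) as P1. pose proof (Cmod_ge_0 z2) as P2.
pose proof (Cmod_ge_0 (z1 - z2)%C) as P3.
rewrite CP_minus_eq by (apply abs_summable_le_r with r; [lra|assumption]).
assert (Hb : forall n, Cmod (RtoC (a n) * (z1 ^ n - z2 ^ n))%C <=
   (Cmod (z1 - z2)%C / r) * (Rabs (theta a n) * r ^ n)).
{ intros [|n].
  - simpl. replace (RtoC (a 0%nat) * (1 - 1))%C with (RtoC 0) by ring. rewrite Cmod_0.
    unfold theta; simpl. rewrite Rmult_0_l, Rabs_R0. lra.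
  - rewrite Cmod_mult, Cmod_R. unfold theta.
    rewrite Rabs_mult, (Rabs_right (INR (S n))) by (apply Rle_ge, pos_INR).
    apply Rle_trans with (Rabs (a (S n)) * (INR (S n) * r ^ n * Cmod (z1 - z2)%C)).
    + apply Rmult_le_compat_l; [apply Rabs_pos|]. now apply Cmod_pow_sub_le.
    + right. simpl (r ^ S n). field. lra. }
rewrite Rmult_comm, <- Series_scal_l.
assert (He : ex_series (fun n => (Cmod (z1 - z2)%C / r) * (Rabs (theta a n) * r ^ n)))
  by now apply ex_series_scal_R.
apply Rle_trans with (2 := Series_le _ _ (fun n => conj (Cmod_ge_0 _) (Hb n)) He).
apply Cmod_CSeries_le. apply ex_series_le_R with (2 := He).
intro n. rewrite Rabs_right by (apply Rle_ge, Cmod_ge_0). apply Hb.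
Qed.

Definition entire (a : nat -> R) : Prop := forall r, 0 <= r -> abs_summable a r.

Lemma INR_le_pow2 n : INR n <= 2 ^ n.
Proof.
induction n as [|n IH]; simpl; [lra|]. 
assert (1 <= 2 ^ n) by (apply pow_R1_Rle; lra). destruct n; simpl in *; lra.
Qed.

Lemma entire_theta a : entire a -> entire (theta a).
Proof.
intros H r Hr. apply ex_series_le_R with (2 := H (2 * r) ltac:(lra)).
intro n. unfold theta. rewrite Rpow_mult_distr.
assert (0 <= r ^ n) by now apply pow_le. assert (Hp := pos_INR n).
rewrite !Rabs_mult, !Rabs_Rabsolu, (Rabs_right (r ^ n)), (Rabs_right (INR n)) by lra.
rewrite <- Rmult_assoc, (Rmult_comm (Rabs (a n))).
apply Rmult_le_compat_r; [assumption|].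
apply Rmult_le_compat_r; [apply Rabs_pos|apply INR_le_pow2].
Qed.

Lemma entire_decr a : entire a -> entire (fun n => a (S n)).
Proof.
intros H r Hr. assert (H1 := H (r + 1) ltac:(lra)). apply ex_series_incr_1 in H1.
apply ex_series_le_R with (2 := H1). intro n.
assert (0 <= r ^ n) by now apply pow_le. 
rewrite Rabs_mult, Rabs_Rabsolu, (Rabs_right (r ^ n)) by lra.
apply Rmult_le_compat_l; [apply Rabs_pos|].
assert (r ^ n <= (r + 1) ^ n) by (apply pow_incr; lra). simpl.
assert (0 <= (r + 1) ^ n) by (apply pow_le; lra). nra.
Qed.

Lemma entire_incr a : entire a -> entire (PS_incr_1 a).
Proof.
intros H r Hr. apply ex_series_incr_1. simpl.
apply ex_series_ext_R with (fun n => r * (Rabs (a n) * r ^ n)).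
- intro n. ring.
- apply ex_series_scal_R. now apply H.
Qed.

Lemma entire_derive a : entire a -> entire (PS_derive a).
Proof. intro H. exact (entire_decr _ (entire_theta _ H)). Qed.

Lemma entire_le (a b : nat -> R) : (forall n, Rabs (a n) <= Rabs (b n)) -> entire b -> entire a.
Proof. intros H Hb r Hr. apply abs_summable_le with b; auto. Qed.

(** With the constant [n^2 M^n] independent of [h], this survives summation against
    the coefficients of an entire series. *)
Lemma Cmod_pow_second_order (z h : C) (M : R) (n : nat) : 1 <= M -> Cmod z + Cmod h <= M ->
  Cmod ((z + h) ^ S n - z ^ S n - RtoC (INR (S n)) * h * z ^ n)%C
  <= INR (S n) ^ 2 * M ^ S n * Cmod h ^ 2.
Proof.
intros HM Hz. pose proof (Cmod_ge_0 z) as P1. pose proof (Cmod_ge_0 h) as P2.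
induction n as [|n IH].
{ replace ((z + h) ^ 1 - z ^ 1 - RtoC (INR 1) * h * z ^ 0)%C with (RtoC 0) by (simpl; ring).
  rewrite Cmod_0. simpl. nra. }
replace ((z + h) ^ S (S n) - z ^ S (S n) - RtoC (INR (S (S n))) * h * z ^ S n)%C
  with ((z + h) * ((z + h) ^ S n - z ^ S n - RtoC (INR (S n)) * h * z ^ n)
        + RtoC (INR (S n)) * z ^ n * (h * h))%C
  by (rewrite (S_INR (S n)), RtoC_plus; simpl (_ ^ _)%C; ring).
apply Rle_trans with (1 := Cmod_triangle _ _).
rewrite !Cmod_mult, Cmod_R, Cmod_pow, Rabs_right by (apply Rle_ge, pos_INR).
assert (Hzh : Cmod (z + h)%C <= M) by (apply Rle_trans with (1 := Cmod_triangle _ _); lra).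
assert (Hzn : Cmod z ^ n <= M ^ S (S n)).
{ apply Rle_trans with (M ^ n); [apply pow_incr; lra|]. apply Rle_pow; [lra|lia]. }
assert (HM0 : 0 <= M ^ S (S n)) by (apply pow_le; lra).
apply Rle_trans with (M * (INR (S n) ^ 2 * M ^ S n * Cmod h ^ 2)
   + INR (S n) * M ^ S (S n) * Cmod h ^ 2).
- apply Rplus_le_compat.
  + apply Rmult_le_compat; auto; apply Cmod_ge_0.
  + replace (Cmod h ^ 2) with (Cmod h * Cmod h) by ring.
    apply Rmult_le_compat_r; [nra|]. apply Rmult_le_compat_l; [apply pos_INR|assumption].
- replace (M * (INR (S n) ^ 2 * M ^ S n * Cmod h ^ 2) + INR (S n) * M ^ S (S n) * Cmod h ^ 2)
    with ((INR (S n) ^ 2 + INR (S n)) * (M ^ S (S n) * Cmod h ^ 2)) by (simpl; ring).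
  rewrite Rmult_assoc. apply Rmult_le_compat_r.
  + apply Rmult_le_pos; [assumption|apply pow2_ge_0].
  + rewrite (S_INR (S n)). assert (Hp := pos_INR (S n)). nra.
Qed.

Lemma is_derive_of_quadratic_remainder (f : C -> C) (z l : C) (K : R) :
  (forall h, Cmod h <= 1 -> Cmod (f (z + h) - f z - h * l)%C <= K * Cmod h ^ 2) ->
  @is_derive C_AbsRing C_NormedModule f z l.
Proof.
intros H. split; [apply is_linear_scal_l|].
intros x Hx.
apply (is_filter_lim_locally_unique (K := C_AbsRing)
  (V := AbsRing_NormedModule C_AbsRing)) in Hx.
rewrite <- Hx. clear x Hx. intros eps.
assert (He := cond_pos eps).
assert (Hd : 0 < Rmin 1 (eps / (Rabs K + 1))).
{ apply Rmin_pos; [lra|]. apply Rdiv_lt_0_compat; [assumption|]. pose proof (Rabs_pos K); lra. }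
exists (mkposreal _ Hd). intros y Hy.
change (Cmod (y - z)%C < Rmin 1 (eps / (Rabs K + 1))) in Hy.
change (Cmod (f y - f z - (y - z) * l)%C <= eps * Cmod (y - z)%C).
replace (f y) with (f (z + (y - z))%C) by (f_equal; ring).
assert (H1 := Rlt_le_trans _ _ _ Hy (Rmin_l _ _)).
assert (H2 := Rlt_le_trans _ _ _ Hy (Rmin_r _ _)).
apply Rle_trans with (1 := H (y - z)%C ltac:(lra)).
pose proof (Cmod_ge_0 (y - z)%C). pose proof (Rle_abs K). pose proof (Rabs_pos K).
assert (Hk : (Rabs K + 1) * Cmod (y - z)%C <= eps).
{ apply Rmult_le_reg_l with (/ (Rabs K + 1)); [apply Rinv_0_lt_compat; lra|].
  rewrite <- Rmult_assoc, Rinv_l by lra. unfold Rdiv in H2. lra. }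
simpl. nra.
Qed.

Lemma is_derive_CP a z : entire a ->
  @is_derive C_AbsRing C_NormedModule (CP a) z (CP (PS_derive a) z).
Proof.
intros Ha. pose proof (Cmod_ge_0 z) as P1. set (M := Cmod z + 1).
assert (Ht := entire_theta _ (entire_theta _ Ha) M ltac:(unfold M; lra)).
apply is_derive_of_quadratic_remainder with
  (Series (fun n => Rabs (theta (theta a) n) * M ^ n)).
intros h Hh. pose proof (Cmod_ge_0 h) as P2.
assert (E1 : forall y, C_abs_summable (fun n => RtoC (a n) * y ^ n)%C)
  by (intro y; apply C_abs_summable_term, Ha, Cmod_ge_0).
(* The derivative series is indexed back so that its n-th term matches degree n. *)
assert (E2 : (h * CP (PS_derive a) z)%C =
   CSeries (fun n => RtoC (a n) * (RtoC (INR n) * h * z ^ pred n))%C).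
{ unfold CP. rewrite <- CSeries_scal.
  - rewrite (CSeries_incr_1 (fun n => RtoC (a n) * (RtoC (INR n) * h * z ^ pred n)))%C
      by (simpl; ring).
    apply CSeries_ext. intro n. unfold PS_derive. rewrite RtoC_mult. simpl pred. ring.
  - apply C_abs_summable_term, entire_derive; [assumption|apply Cmod_ge_0]. }
assert (Hb : forall n, Cmod (RtoC (a n) * ((z + h) ^ n - z ^ n - RtoC (INR n) * h * z ^ pred n))%C
   <= Cmod h ^ 2 * (Rabs (theta (theta a) n) * M ^ n)).
{ intros [|n].
  - simpl. replace (RtoC (a 0%nat) * (1 - 1 - 0 * h * 1))%C with (RtoC 0) by ring.
    rewrite Cmod_0. unfold theta; simpl. rewrite !Rmult_0_l, Rabs_R0. lra.
  - rewrite Cmod_mult, Cmod_R. simpl pred. unfold theta.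
    rewrite !Rabs_mult, (Rabs_right (INR (S n))) by (apply Rle_ge, pos_INR).
    apply Rle_trans with (Rabs (a (S n)) * (INR (S n) ^ 2 * M ^ S n * Cmod h ^ 2)).
    + apply Rmult_le_compat_l; [apply Rabs_pos|].
      apply Cmod_pow_second_order; unfold M; lra.
    + right; ring. }
assert (Hs := ex_series_scal_R (Cmod h ^ 2) _ Ht).
replace (CP a (z + h) - CP a z - h * CP (PS_derive a) z)%C with
  (CSeries (fun n => RtoC (a n) * ((z + h) ^ n - z ^ n - RtoC (INR n) * h * z ^ pred n)))%C.
- rewrite Rmult_comm, <- Series_scal_l.
  apply Rle_trans with (2 := Series_le _ _ (fun n => conj (Cmod_ge_0 _) (Hb n)) Hs).
  apply Cmod_CSeries_le. apply ex_series_le_R with (2 := Hs).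
  intro n. rewrite Rabs_right by (apply Rle_ge, Cmod_ge_0). apply Hb.
- rewrite E2, CP_minus_eq by (apply Ha, Cmod_ge_0).
  set (v := fun n => (RtoC (a n) * (RtoC (INR n) * h * z ^ pred n))%C).
  set (r := fun n => (RtoC (a n) * ((z + h) ^ n - z ^ n - RtoC (INR n) * h * z ^ pred n))%C).
  assert (Hr : C_abs_summable r).
  { apply ex_series_le_R with (2 := Hs).
    intro n. rewrite Rabs_right by (apply Rle_ge, Cmod_ge_0). apply Hb. }
  assert (Hv : C_abs_summable v).
  { unfold C_abs_summable. apply ex_series_incr_1.
    apply ex_series_ext_R with (fun n => Cmod h * (Rabs (PS_derive a n) * Cmod z ^ n)).
    - intro n. unfold v, PS_derive. rewrite !Cmod_mult, !Cmod_R, Cmod_pow, Rabs_mult.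
      simpl pred. ring.
    - apply ex_series_scal_R, entire_derive; [assumption|apply Cmod_ge_0]. }
  replace (CSeries (fun n => RtoC (a n) * ((z + h) ^ n - z ^ n))%C)
    with (CSeries r + CSeries v)%C; [ring|].
  rewrite <- CSeries_plus by assumption. apply CSeries_ext. intro n. unfold r, v. ring.
Qed.

Lemma C_derive_CP a : entire a -> C_derive (CP a) = CP (PS_derive a).
Proof.
intro Ha. apply functional_extensionality. intro z.
now apply is_C_derive_unique, is_derive_CP.
Qed.

Lemma analytic_CP a : entire a -> analytic_disk (CP a).
Proof. intros Ha z _. eexists. now apply is_derive_CP. Qed.

(** * Dominant constant terms *)

Lemma entire_plus a b : entire a -> entire b -> entire (fun n => a n + b n).
Proof.
intros Ha Hb r Hr.
apply ex_series_le_R with (2 := ex_series_plus (V := R_NormedModule) _ _ (Ha r Hr) (Hb r Hr)).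
intro n. assert (0 <= r ^ n) by now apply pow_le.
rewrite Rabs_mult, Rabs_Rabsolu, (Rabs_right (r ^ n)) by lra.
unfold plus; simpl. rewrite <- Rmult_plus_distr_r.
apply Rmult_le_compat_r; [assumption|apply Rabs_triang].
Qed.

Lemma entire_scal c a : entire a -> entire (fun n => c * a n).
Proof.
intros Ha r Hr.
apply ex_series_ext_R with (fun n => Rabs c * (Rabs (a n) * r ^ n)).
- intro n. rewrite Rabs_mult. ring.
- apply ex_series_scal_R. now apply Ha.
Qed.

Lemma abs_summable_decr a r : 0 <= r -> abs_summable a r -> abs_summable (fun n => a (S n)) r.
Proof.
intros Hr H. destruct (Req_dec r 0) as [->|H0].
- apply ex_series_incr_1. apply ex_series_ext_R with (fun _ => 0 * 0).
  + intro n. simpl. ring.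
  + apply (ex_series_scal_R 0 (fun _ => 0)). exists 0.
    apply is_series_Reals. intros eps He. exists 0%nat. intros n _.
    rewrite sum_eq_R0 by reflexivity. unfold R_dist. rewrite Rminus_diag, Rabs_R0. assumption.
- apply ex_series_incr_1 in H.
  apply ex_series_ext_R with (fun n => / r * (Rabs (a (S n)) * r ^ S n)).
  + intro n. simpl. field. assumption.
  + now apply ex_series_scal_R.
Qed.

Lemma CSeries_head u : C_abs_summable u ->
  CSeries u = (u 0%nat + CSeries (fun n => u (S n)))%C.
Proof.
intro H. apply C_eq; simpl; apply Series_incr_1, ex_series_Rabs;
  [exact (ex_series_Re _ H)|exact (ex_series_Im _ H)].
Qed.

Lemma CP_decr a z : abs_summable a (Cmod z) ->
  CP a z = (RtoC (a 0%nat) + z * CP (fun n => a (S n)) z)%C.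
Proof.
intro H. assert (H' := C_abs_summable_term _ _ (abs_summable_decr a _ (Cmod_ge_0 z) H)).
apply C_abs_summable_term in H. unfold CP. rewrite <- CSeries_scal by assumption.
rewrite (CSeries_head _ H). f_equal.
- simpl. ring.
- apply CSeries_ext. intro n. simpl. ring.
Qed.

(** The constant coefficient of [a] outweighs all the others, so [CP a] stays
    in a half plane on the closed unit disk. *)
Definition dominant (a : nat -> R) : Prop :=
  ex_series (fun n => Rabs (a n)) /\ Series (fun n => Rabs (a (S n))) < Rabs (a 0%nat).

Lemma abs_summable_1 a : ex_series (fun n => Rabs (a n)) -> abs_summable a 1.
Proof. apply ex_series_ext_R. intro n. rewrite pow1. ring. Qed.

Lemma abs_summable_disk a z : ex_series (fun n => Rabs (a n)) -> Cmod z <= 1 ->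
  abs_summable a (Cmod z).
Proof.
intros H Hz. apply abs_summable_le_r with 1; [|now apply abs_summable_1].
split; [apply Cmod_ge_0|assumption].
Qed.

Lemma Series_abs_1 (a : nat -> R) :
  Series (fun n => Rabs (a n) * 1 ^ n) = Series (fun n => Rabs (a n)).
Proof. apply Series_ext. intro n. rewrite pow1. ring. Qed.

Lemma dominant_Re_pos a z : dominant a -> Cmod z <= 1 ->
  0 < Re (CP a z / RtoC (a 0%nat))%C.
Proof.
intros [Ha Hd] Hz.
assert (H0 : a 0%nat <> 0).
{ intro H0. rewrite H0, Rabs_R0 in Hd.
  assert (0 <= Series (fun n => Rabs (a (S n)))); [|lra].
  rewrite <- (Series_zero (fun _ => 0)) by reflexivity. apply Series_le.
  - intro n; split; [lra|apply Rabs_pos].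
  - now apply ex_series_incr_1 in Ha. }
rewrite CP_decr by now apply abs_summable_disk.
assert (H0' : RtoC (a 0%nat) <> 0%C) by (intro H; apply H0; now apply RtoC_inj).
set (y := (z * CP (fun n => a (S n)) z)%C).
replace ((RtoC (a 0%nat) + y) / RtoC (a 0%nat))%C with (1 + y / RtoC (a 0%nat))%C
  by (field; exact H0').
assert (Hy : Cmod (y / RtoC (a 0%nat))%C < 1).
{ rewrite Cmod_div, Cmod_R by assumption. apply Rlt_div_l; [now apply Rabs_pos_lt|].
  rewrite Rmult_1_l. apply Rle_lt_trans with (2 := Hd).
  unfold y. rewrite Cmod_mult. rewrite <- (Series_abs_1 (fun n => a (S n))).
  assert (H1 : abs_summable (fun n => a (S n)) 1).
  { apply abs_summable_1. now apply ex_series_incr_1 in Ha. }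
  assert (H2 := Cmod_CP_le _ z 1 Hz H1).
  pose proof (Cmod_ge_0 z). pose proof (Cmod_ge_0 (CP (fun n => a (S n)) z)). nra. }
assert (H1 := re_le_Cmod (y / RtoC (a 0%nat))%C).
apply Rle_lt_trans with (2 := Hy), Rabs_def2 in H1.
change (0 < 1 + Re (y / RtoC (a 0%nat))%C). lra.
Qed.

(** The linear term [a 1 * (z1 - z2)] of a difference of values beats the rest,
    which is Lipschitz with constant [sum_(n >= 2) n |a n| < |a 1|]. *)
Lemma dominant_derive_remainder a z1 z2 : ex_series (fun n => Rabs (a n)) ->
  dominant (PS_derive a) -> Cmod z1 <= 1 -> Cmod z2 <= 1 -> z1 <> z2 ->
  Cmod (CP a z1 - CP a z2 - RtoC (a 1%nat) * (z1 - z2))%C < Rabs (a 1%nat) * Cmod (z1 - z2)%C.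
Proof.
intros Ha [Hd1 Hd2] Hz1 Hz2 Hz.
set (b := fun n => match n with O => 0 | S O => 0 | n => a n end).
assert (Hb : ex_series (fun n => Rabs (b n))).
{ apply ex_series_le_R with (2 := Ha). intro n. rewrite Rabs_Rabsolu.
  destruct n as [|[|n]]; simpl; try apply Rle_refl; rewrite Rabs_R0; apply Rabs_pos. }
assert (Hab : forall z, Cmod z <= 1 -> CP a z = (RtoC (a 0%nat) + RtoC (a 1%nat) * z + CP b z)%C).
{ intros z Hc. pose proof (Cmod_ge_0 z).
  assert (Sa := abs_summable_disk a z Ha Hc). assert (Sb := abs_summable_disk b z Hb Hc).
  rewrite (CP_decr a), (CP_decr (fun n => a (S n))) by auto using abs_summable_decr.
  rewrite (CP_decr b), (CP_decr (fun n => b (S n))) by auto using abs_summable_decr.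
  unfold b. ring. }
rewrite !Hab by assumption.
replace (RtoC (a 0%nat) + RtoC (a 1%nat) * z1 + CP b z1
  - (RtoC (a 0%nat) + RtoC (a 1%nat) * z2 + CP b z2) - RtoC (a 1%nat) * (z1 - z2))%C
  with (CP b z1 - CP b z2)%C by ring.
assert (Hpos : 0 < Cmod (z1 - z2)%C).
{ apply Cmod_gt_0. intro H. apply Hz. replace z1 with (z1 - z2 + z2)%C by ring.
  rewrite H. ring. }
assert (Ht : forall n, Rabs (theta b (S (S n))) = Rabs (PS_derive a (S n))) by reflexivity.
assert (Hd1' := Hd1). apply ex_series_incr_1 in Hd1'.
assert (Htb : ex_series (fun n => Rabs (theta b n))).
{ apply ex_series_incr_1, ex_series_incr_1. exact Hd1'. }
assert (HL := CP_lipschitz b z1 z2 1 Rlt_0_1 Hz1 Hz2 (abs_summable_1 _ Hb) (abs_summable_1 _ Htb)).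
apply Rle_lt_trans with (1 := HL). rewrite Series_abs_1.
rewrite Series_incr_1_aux, Series_incr_1_aux
  by (unfold theta, b; rewrite Rmult_0_r; apply Rabs_R0).
replace (PS_derive a 0%nat) with (a 1%nat) in Hd2 by (unfold PS_derive; simpl; ring).
replace (Cmod (z1 - z2)%C / 1) with (Cmod (z1 - z2)%C) by field.
now apply Rmult_lt_compat_r.
Qed.

Lemma dominant_derive_injective a z1 z2 : ex_series (fun n => Rabs (a n)) ->
  dominant (PS_derive a) -> Cmod z1 <= 1 -> Cmod z2 <= 1 -> CP a z1 = CP a z2 -> z1 = z2.
Proof.
intros Ha Hd Hz1 Hz2 Heq.
destruct (Ceq_dec z1 z2) as [H|H]; [assumption|exfalso].
assert (H1 := dominant_derive_remainder a z1 z2 Ha Hd Hz1 Hz2 H).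
rewrite Heq in H1.
replace (CP a z2 - CP a z2 - RtoC (a 1%nat) * (z1 - z2))%C
  with (- (RtoC (a 1%nat) * (z1 - z2)))%C in H1 by ring.
rewrite Cmod_opp, Cmod_mult, Cmod_R in H1. lra.
Qed.

Lemma entire_abs a : entire a -> ex_series (fun n => Rabs (a n)).
Proof.
intro H. apply ex_series_ext_R with (2 := H 1 Rle_0_1). intro n. rewrite pow1. ring.
Qed.

Lemma is_derive_linear (c : R) (z : C) :
  @is_derive C_AbsRing C_NormedModule (fun z => RtoC c * z)%C z (RtoC c).
Proof.
apply is_derive_of_quadratic_remainder with 0. intros h _.
replace (RtoC c * (z + h) - RtoC c * z - h * RtoC c)%C with (RtoC 0) by ring.
rewrite Cmod_0. lra.
Qed.

Lemma convex_univalent_linear (c : R) : c <> 0 -> convex_univalent (fun z => RtoC c * z)%C.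
Proof.
intro Hc. assert (Hc' : RtoC c <> 0%C) by (intro H; apply Hc; now apply RtoC_inj).
split; [split|].
- intros z _. eexists. apply is_derive_linear.
- intros z1 z2 _ _ H. replace z1 with (/ RtoC c * (RtoC c * z1))%C by (field; assumption).
  rewrite H. field. assumption.
- intros p q t (zp & Hp & <-) (zq & Hq & <-) Ht.
  exists (RtoC (1 - t) * zp + RtoC t * zq)%C. split; [|ring].
  unfold disk in *. apply Rle_lt_trans with (1 := Cmod_triangle _ _).
  rewrite !Cmod_mult, !Cmod_R, !Rabs_right by lra.
  set (m := Rmax (Cmod zp) (Cmod zq)).
  assert (Hm : m < 1) by now apply Rmax_lub_lt.
  assert (Cmod zp <= m) by apply Rmax_l. assert (Cmod zq <= m) by apply Rmax_r.
  apply Rle_lt_trans with (2 := Hm).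
  replace m with ((1 - t) * m + t * m) by ring.
  apply Rplus_le_compat; apply Rmult_le_compat_l; lra.
Qed.

(** Noshiro-Warschawski with the linear comparison function [c z]. *)
Lemma close_to_convex_of_dominant a : entire a -> dominant (PS_derive a) ->
  close_to_convex (CP a).
Proof.
intros Ha Hd. split; [now apply analytic_CP|].
set (c := PS_derive a 0%nat).
assert (Hc : c <> 0).
{ intro H. destruct Hd as [Hs Hd]. fold c in Hd. rewrite H, Rabs_R0 in Hd.
  assert (0 <= Series (fun n => Rabs (PS_derive a (S n)))); [|lra].
  rewrite <- (Series_zero (fun _ => 0)) by reflexivity. apply Series_le.
  - intro n; split; [lra|apply Rabs_pos].
  - now apply ex_series_incr_1 in Hs. }
exists (fun z => RtoC c * z)%C. split; [now apply convex_univalent_linear|].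
intros z Hz. rewrite C_derive_CP by assumption.
replace (C_derive (fun z => RtoC c * z)%C z) with (RtoC c)
  by (symmetry; apply is_C_derive_unique, is_derive_linear).
apply dominant_Re_pos; [assumption|]. unfold disk in Hz; lra.
Qed.

Lemma univalent_of_dominant a : entire a -> dominant (PS_derive a) -> univalent (CP a).
Proof.
intros Ha Hd. split; [now apply analytic_CP|]. unfold disk. intros z1 z2 H1 H2.
apply dominant_derive_injective; auto using entire_abs; lra.
Qed.

Lemma dominant_of_ratio a : a 0%nat <> 0 -> Rabs (a 1%nat) <= 3 / 5 * Rabs (a 0%nat) ->
  (forall n, Rabs (a (S (S n))) <= / 4 * Rabs (a (S n))) -> dominant a.
Proof.
intros H0 H1 H.
assert (Hn : forall n, Rabs (a (S n)) <= (3 / 5 * Rabs (a 0%nat)) * (/ 4) ^ n).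
{ induction n as [|n IH]; [simpl; lra|].
  apply Rle_trans with (1 := H n). simpl. lra. }
assert (Hg : is_series (fun n => (3 / 5 * Rabs (a 0%nat)) * (/ 4) ^ n)
   (3 / 5 * Rabs (a 0%nat) * / (1 - / 4))).
{ apply (is_series_scal (V := R_NormedModule)), is_series_geom.
  rewrite Rabs_right; lra. }
assert (Hpos : 0 < Rabs (a 0%nat)) by now apply Rabs_pos_lt.
split.
- apply ex_series_incr_1. apply ex_series_le_R with (2 := ex_intro _ _ Hg).
  intro n. rewrite Rabs_Rabsolu. apply Hn.
- apply Rle_lt_trans with (3 / 5 * Rabs (a 0%nat) * / (1 - / 4)).
  + rewrite <- (is_series_unique _ _ Hg). apply Series_le; [|eexists; exact Hg].
    intro n; split; [apply Rabs_pos|apply Hn].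
  + lra.
Qed.

(** * Coefficients of [w] and of its derivatives *)

Fixpoint rising (x : R) (n : nat) : R :=
  match n with O => 1 | S m => rising x m * (x + INR m) end.

Lemma rising_pos x n : 0 < x -> 0 < rising x n.
Proof.
intro Hx. induction n as [|n IH]; simpl; [lra|].
apply Rmult_lt_0_compat; [assumption|]. pose proof (pos_INR n); lra.
Qed.

Lemma Gamma_rising x n : 0 < x -> Gamma (x + INR n) = rising x n * Gamma x.
Proof.
intro Hx. induction n as [|n IH].
- simpl. rewrite Rplus_0_r. ring.
- rewrite S_INR. replace (x + (INR n + 1)) with (x + INR n + 1) by ring.
  rewrite Gamma_succ by (pose proof (pos_INR n); lra). rewrite IH. simpl. ring.
Qed.

(** The normalized Bessel function [Gamma (nu + 1) (2 / sqrt z)^nu J_nu (sqrt z)]. *)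
Definition bessel_coef (nu : R) (n : nat) : R :=
  (-1) ^ n / (4 ^ n * INR (fact n) * rising (nu + 1) n).

Lemma bessel_coef_0 nu : bessel_coef nu 0 = 1.
Proof. unfold bessel_coef; simpl. field. Qed.

Lemma bessel_coef_S nu n : 0 < nu + 1 ->
  bessel_coef nu (S n) = - bessel_coef nu n / (4 * INR (S n) * (nu + INR (S n))).
Proof.
intro H. unfold bessel_coef. rewrite fact_simpl, mult_INR. simpl rising. rewrite S_INR.
pose proof (pos_INR n). pose proof (rising_pos (nu + 1) n H). pose proof (INR_fact_neq_0 n).
assert (4 ^ n <> 0) by (apply pow_nonzero; lra).
simpl pow. field. repeat split; try assumption; lra.
Qed.

Lemma bessel_coef_neq_0 nu n : 0 < nu + 1 -> bessel_coef nu n <> 0.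
Proof.
intro H. unfold bessel_coef, Rdiv. apply Rmult_integral_contrapositive_currified.
- apply pow_nonzero; lra.
- apply Rinv_neq_0_compat. pose proof (rising_pos (nu + 1) n H). 
  repeat apply Rmult_integral_contrapositive_currified; try lra; 
    [apply pow_nonzero; lra|apply INR_fact_neq_0].
Qed.

Lemma entire_inv_fact : entire (fun n => / INR (fact n)).
Proof.
intros r Hr. exists (exp r). apply is_series_ext with (2 := is_exp_Reals r).
intro n. unfold scal; simpl; unfold mult; simpl. rewrite pow_n_pow.
rewrite Rabs_right; [apply Rmult_comm|].
apply Rle_ge, Rlt_le, Rinv_0_lt_compat, INR_fact_lt_0.
Qed.

Lemma entire_bessel_coef nu : - (3 / 4) < nu -> entire (bessel_coef nu).
Proof.
intro H. apply entire_le with (2 := entire_inv_fact). intro n.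
induction n as [|n IH].
{ rewrite bessel_coef_0. simpl. rewrite Rinv_1. lra. }
rewrite bessel_coef_S by lra. rewrite fact_simpl, mult_INR.
unfold Rdiv. rewrite (Rinv_mult (INR (S n)) (INR (fact n))), !(Rabs_mult _ (/ _)).
rewrite Rabs_Ropp, Rmult_comm.
apply Rmult_le_compat; try apply Rabs_pos; [|assumption].
assert (H1 : 1 <= INR (S n)) by (rewrite S_INR; pose proof (pos_INR n); lra).
assert (H2 : INR (S n) <= 4 * INR (S n) * (nu + INR (S n))) by nra.
rewrite !Rabs_right by (apply Rle_ge, Rlt_le, Rinv_0_lt_compat; lra).
apply Rinv_le_contravar; lra.
Qed.

Lemma w_coef_bessel a nu n : 0 < a -> 0 < nu + 1 ->
  w_coef a nu n = bessel_coef nu n + 2 / a * theta (bessel_coef nu) n.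
Proof.
intros Ha Hn. unfold w_coef, theta, bessel_coef.
replace (INR n + nu + 1) with (nu + 1 + INR n) by ring. rewrite Gamma_rising by assumption.
pose proof (Gamma_pos (nu + 1) Hn). pose proof (rising_pos (nu + 1) n Hn).
pose proof (INR_fact_neq_0 n). assert (4 ^ n <> 0) by (apply pow_nonzero; lra).
field. repeat split; try assumption; lra.
Qed.

Lemma w_coef_0 a nu : 0 < a -> 0 < nu + 1 -> w_coef a nu 0 = 1.
Proof.
intros. rewrite w_coef_bessel, bessel_coef_0 by assumption. unfold theta; simpl. ring.
Qed.

Lemma entire_w_coef a nu : 0 < a -> - (3 / 4) < nu -> entire (w_coef a nu).
Proof.
intros Ha Hn. apply entire_le with (fun n => bessel_coef nu n + 2 / a * theta (bessel_coef nu) n).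
- intro n. rewrite w_coef_bessel by lra. apply Rle_refl.
- apply entire_plus; [now apply entire_bessel_coef|].
  now apply entire_scal, entire_theta, entire_bessel_coef.
Qed.

Lemma w_coef_S a nu n : 0 < a -> 0 < nu + 1 ->
  w_coef a nu (S n) = - w_coef a nu n * (2 * INR (S n) + a) /
    ((2 * INR n + a) * (4 * INR (S n) * (nu + INR (S n)))).
Proof.
intros Ha Hn. rewrite !w_coef_bessel by assumption. unfold theta.
rewrite bessel_coef_S, S_INR by assumption. pose proof (pos_INR n).
field. repeat split; lra.
Qed.

Lemma w_coef_neq_0 a nu n : 0 < a -> 0 < nu + 1 -> w_coef a nu n <> 0.
Proof.
intros Ha Hn. rewrite w_coef_bessel by assumption. unfold theta.
replace (bessel_coef nu n + 2 / a * (INR n * bessel_coef nu n))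
  with (bessel_coef nu n * ((a + 2 * INR n) / a)) by (field; lra).
apply Rmult_integral_contrapositive_currified; [now apply bessel_coef_neq_0|].
pose proof (pos_INR n). apply Rgt_not_eq, Rdiv_lt_0_compat; lra.
Qed.

Lemma w_eq_CP a nu : w a nu = CP (PS_incr_1 (w_coef a nu)).
Proof.
apply functional_extensionality. intro z. unfold w, CP.
rewrite (CSeries_incr_1 (fun n => RtoC (PS_incr_1 (w_coef a nu) n) * z ^ n)%C)
  by (change (PS_incr_1 (w_coef a nu) 0%nat) with 0; ring).
reflexivity.
Qed.

Lemma w_eq_mul a nu z : 0 < a -> - (3 / 4) < nu ->
  w a nu z = (z * CP (w_coef a nu) z)%C.
Proof.
intros Ha Hn. rewrite w_eq_CP, CP_decr.
- change (PS_incr_1 (w_coef a nu) 0%nat) with 0.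
  change (fun n => PS_incr_1 (w_coef a nu) (S n)) with (w_coef a nu). ring.
- apply entire_incr; [now apply entire_w_coef|apply Cmod_ge_0].
Qed.

Lemma PS_derive_n_S k a : PS_derive (PS_derive_n k a) = PS_derive_n (S k) a.
Proof.
apply functional_extensionality. intro n. unfold PS_derive, PS_derive_n.
replace (n + S k)%nat with (S n + k)%nat by lia.
rewrite (fact_simpl n), mult_INR.
pose proof (INR_fact_neq_0 n). assert (INR (S n) <> 0) by (apply not_0_INR; lia).
field. split; assumption.
Qed.

Lemma entire_derive_n k a : entire a -> entire (PS_derive_n k a).
Proof.
intro H. induction k as [|k IH].
- apply entire_le with (2 := H). intro n. unfold PS_derive_n.
  rewrite Nat.add_0_r. right. f_equal. field. apply INR_fact_neq_0.
- rewrite <- PS_derive_n_S. now apply entire_derive.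
Qed.

Lemma C_derive_n_CP k a : entire a -> C_derive_n (CP a) k = CP (PS_derive_n k a).
Proof.
intro H. induction k as [|k IH].
- simpl. f_equal. apply functional_extensionality. intro n. unfold PS_derive_n.
  rewrite Nat.add_0_r. field. apply INR_fact_neq_0.
- change (C_derive (C_derive_n (CP a) k) = CP (PS_derive_n (S k) a)). rewrite IH, C_derive_CP by now apply entire_derive_n.
  now rewrite PS_derive_n_S.
Qed.

Definition w_derive_coef (a nu : R) (k : nat) : nat -> R :=
  PS_derive_n k (PS_incr_1 (w_coef a nu)).

Lemma entire_w_derive_coef a nu k : 0 < a -> - (3 / 4) < nu -> entire (w_derive_coef a nu k).
Proof. intros. now apply entire_derive_n, entire_incr, entire_w_coef. Qed.

Lemma w_derive_coef_S a nu k m : 0 < a -> 0 < nu + 1 ->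
  w_derive_coef a nu (S k) (S m) = - w_derive_coef a nu (S k) m *
   ((INR (m + k) + 2) / (INR m + 1) * ((2 * INR (m + k) + 2 + a) /
    ((2 * INR (m + k) + a) * (4 * (INR (m + k) + 1) * (nu + 1 + INR (m + k)))))).
Proof.
intros Ha Hn. unfold w_derive_coef, PS_derive_n.
replace (S m + S k)%nat with (S (S (m + k))) by lia.
replace (m + S k)%nat with (S (m + k)) by lia.
simpl PS_incr_1. rewrite w_coef_S by assumption.
rewrite !(fact_simpl (S _)), !(fact_simpl m), !mult_INR, !S_INR.
pose proof (pos_INR (m + k)). pose proof (pos_INR m).
pose proof (INR_fact_neq_0 m). pose proof (INR_fact_neq_0 (S (m + k))).
field. repeat split; try assumption; lra.
Qed.

(** The quotient of consecutive coefficients of [w^(k+1)] at index [m], where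
    [n = m + k] and [s = m + 1], bounded uniformly in [a] and [nu]. *)
Lemma ratio_bound (a nu n s : R) : 0 < a -> - (3 / 4) < nu -> 1 <= n -> 1 <= s ->
  0 <= (n + 2) / s * ((2 * n + 2 + a) / ((2 * n + a) * (4 * (n + 1) * (nu + 1 + n))))
  <= (n + 2) / (s * (n * (4 * n + 1))).
Proof.
intros Ha Hn H1 Hs. split.
- apply Rmult_le_pos; apply Rlt_le, Rdiv_lt_0_compat; try lra.
  repeat apply Rmult_lt_0_compat; lra.
- replace ((n + 2) / (s * (n * (4 * n + 1)))) with ((n + 2) / s * / (n * (4 * n + 1)))
    by (field; repeat split; nra).
  apply Rmult_le_compat_l; [apply Rlt_le, Rdiv_lt_0_compat; lra|].
  apply Rle_div_l; [repeat apply Rmult_lt_0_compat; lra|].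
  rewrite (Rmult_comm (/ _)). apply Rle_div_r; [apply Rmult_lt_0_compat; lra|].
  assert (E1 : n * (2 * n + 2 + a) <= (2 * n + a) * (n + 1)) by nra.
  assert (E2 : 4 * n + 1 <= 4 * (nu + 1 + n)) by lra.
  replace ((2 * n + a) * (4 * (n + 1) * (nu + 1 + n)))
    with ((2 * n + a) * (n + 1) * (4 * (nu + 1 + n))) by ring.
  replace ((2 * n + 2 + a) * (n * (4 * n + 1))) with (n * (2 * n + 2 + a) * (4 * n + 1)) by ring.
  apply Rmult_le_compat; nra.
Qed.

(** Every derivative from the second on is dominated by its value at 0: for all
    [nu > -3/4] the ratio of consecutive coefficients is at most 3/5 at the start
    and at most 1/4 afterwards. *)
Lemma dominant_w_derive_coef a nu k : 0 < a -> - (3 / 4) < nu -> (1 <= k)%nat ->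
  dominant (w_derive_coef a nu (S k)).
Proof.
intros Ha Hn Hk. assert (H1 : 1 <= INR k) by (apply (le_INR 1); assumption).
apply dominant_of_ratio.
- unfold w_derive_coef, PS_derive_n. simpl (0 + S k)%nat. simpl PS_incr_1.
  apply Rmult_integral_contrapositive_currified; [|apply w_coef_neq_0; lra].
  unfold Rdiv. apply Rmult_integral_contrapositive_currified; [apply INR_fact_neq_0|].
  apply Rinv_neq_0_compat, INR_fact_neq_0.
- rewrite w_derive_coef_S by lra. rewrite Rabs_mult, Rabs_Ropp, Rmult_comm.
  apply Rmult_le_compat_r; [apply Rabs_pos|]. simpl (0 + k)%nat.
  assert (B := ratio_bound a nu (INR k) (INR 0 + 1) Ha Hn H1 ltac:(simpl; lra)).
  rewrite Rabs_right by lra. apply Rle_trans with (1 := proj2 B). simpl INR.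
  apply Rle_div_l; [repeat apply Rmult_lt_0_compat; lra|]. nra.
- intro m. rewrite w_derive_coef_S by lra. rewrite Rabs_mult, Rabs_Ropp, Rmult_comm.
  apply Rmult_le_compat_r; [apply Rabs_pos|].
  assert (H2 : 2 <= INR (S m + k)) by (apply (le_INR 2); lia).
  assert (H3 : 2 <= INR (S m) + 1) by (rewrite S_INR; pose proof (pos_INR m); lra).
  assert (B := ratio_bound a nu (INR (S m + k)) (INR (S m) + 1) Ha Hn ltac:(lra) ltac:(lra)).
  rewrite Rabs_right by lra. apply Rle_trans with (1 := proj2 B).
  set (n := INR (S m + k)) in *. set (s := INR (S m) + 1) in *.
  apply Rle_div_l; [repeat apply Rmult_lt_0_compat; lra|].
  assert (2 * (n * (4 * n + 1)) <= s * (n * (4 * n + 1))) by (apply Rmult_le_compat_r; nra).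
  nra.
Qed.

Lemma C_derive_n_w a nu k : 0 < a -> - (3 / 4) < nu ->
  C_derive_n (w a nu) k = CP (w_derive_coef a nu k).
Proof. intros. rewrite w_eq_CP. now apply C_derive_n_CP, entire_incr, entire_w_coef. Qed.

Lemma close_to_convex_derivatives a nu k : 0 < a -> - (3 / 4) < nu -> (1 <= k)%nat ->
  close_to_convex (C_derive_n (w a nu) k).
Proof.
intros. rewrite C_derive_n_w by assumption. apply close_to_convex_of_dominant.
- now apply entire_w_derive_coef.
- unfold w_derive_coef. rewrite PS_derive_n_S. now apply dominant_w_derive_coef.
Qed.

Lemma univalent_derivatives a nu k : 0 < a -> - (3 / 4) < nu -> (1 <= k)%nat ->
  univalent (C_derive_n (w a nu) k).
Proof.
intros. rewrite C_derive_n_w by assumption. apply univalent_of_dominant.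
- now apply entire_w_derive_coef.
- unfold w_derive_coef. rewrite PS_derive_n_S. now apply dominant_w_derive_coef.
Qed.

(** * The real function [w] on the unit interval *)

Lemma abs_summable_CV_radius a r x : abs_summable a r -> Rabs x < r ->
  Rbar_lt (Rabs x) (CV_radius a).
Proof.
intros H Hx. assert (Hr : 0 < r) by (pose proof (Rabs_pos x); lra).
apply Rbar_lt_le_trans with (Finite r); [exact Hx|].
apply Rbar_not_lt_le. intro Hlt. rewrite <- (Rabs_right r) in Hlt by lra.
apply (CV_disk_outside _ _ Hlt).
apply (ex_series_lim_0 (fun n => a n * r ^ n)), ex_series_Rabs.
apply ex_series_ext_R with (2 := H). intro n.
rewrite Rabs_mult, (Rabs_right (r ^ n)); [reflexivity|]. apply Rle_ge, pow_le; lra.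
Qed.

Lemma entire_CV_radius a x : entire a -> Rbar_lt (Rabs x) (CV_radius a).
Proof.
intro H. apply abs_summable_CV_radius with (Rabs x + 1); [|lra].
apply H. pose proof (Rabs_pos x); lra.
Qed.

Lemma ex_series_entire a x : entire a -> ex_series (fun n => a n * x ^ n).
Proof.
intro H. apply ex_series_Rabs. apply ex_series_ext_R with (2 := H (Rabs x) (Rabs_pos x)).
intro n. now rewrite Rabs_mult, RPow_abs.
Qed.

Lemma PS_derive_n_0 a : PS_derive_n 0 a = a.
Proof.
apply functional_extensionality. intro n. unfold PS_derive_n.
rewrite Nat.add_0_r. field. apply INR_fact_neq_0.
Qed.

Lemma is_derive_entire a x : entire a -> is_derive (PSeries a) x (PSeries (PS_derive a) x).
Proof. intro H. now apply is_derive_PSeries, entire_CV_radius. Qed.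

Definition w_real (a nu x : R) : R := PSeries (w_derive_coef a nu 0) x.
Definition w_real' (a nu x : R) : R := PSeries (w_derive_coef a nu 1) x.

Lemma w_eq_w_real a nu x : w a nu (RtoC x) = RtoC (w_real a nu x).
Proof. rewrite w_eq_CP, CP_real. unfold w_real, w_derive_coef. now rewrite PS_derive_n_0. Qed.

Lemma is_derive_w_real a nu x : 0 < a -> - (3 / 4) < nu ->
  is_derive (w_real a nu) x (w_real' a nu x).
Proof.
intros. unfold w_real', w_derive_coef. rewrite <- PS_derive_n_S.
now apply is_derive_entire, entire_w_derive_coef.
Qed.

Lemma continuity_w_real' a nu : 0 < a -> - (3 / 4) < nu -> continuity (w_real' a nu).
Proof. intros ? ? x. now apply PSeries_continuity, entire_CV_radius, entire_w_derive_coef. Qed.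

Lemma w_real'_0 a nu : 0 < a -> 0 < nu + 1 -> w_real' a nu 0 = 1.
Proof.
intros. unfold w_real'. rewrite PSeries_0. unfold w_derive_coef, PS_derive_n. simpl.
rewrite w_coef_0 by assumption. field.
Qed.

Lemma w_real_0 a nu : w_real a nu 0 = 0.
Proof.
unfold w_real. rewrite PSeries_0. unfold w_derive_coef. now rewrite PS_derive_n_0.
Qed.

(** The linear coefficient of [w'] is negative and dominates the higher ones. *)
Lemma w_real'_decreasing a nu x y : 0 < a -> - (3 / 4) < nu -> 0 <= x -> x < y -> y <= 1 ->
  w_real' a nu y < w_real' a nu x.
Proof.
intros Ha Hn Hx Hxy Hy. set (d := w_derive_coef a nu 1).
assert (Hd1 : d 1%nat < 0).
{ unfold d, w_derive_coef, PS_derive_n. simpl PS_incr_1. simpl fact.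
  rewrite w_coef_S, w_coef_0 by lra. simpl INR.
  assert (0 < (2 + a) / (a * (4 * (nu + 1)))).
  { apply Rdiv_lt_0_compat; [lra|]. repeat apply Rmult_lt_0_compat; lra. }
  replace ((1 + 1) / 1 * (- (1) * (2 * 1 + a) / ((2 * 0 + a) * (4 * 1 * (nu + 1)))))
    with (- 2 * ((2 + a) / (a * (4 * (nu + 1))))) by (field; lra).
  lra. }
assert (He : entire d) by now apply entire_w_derive_coef.
assert (Hdom : dominant (PS_derive d)).
{ unfold d, w_derive_coef. rewrite PS_derive_n_S. now apply dominant_w_derive_coef. }
assert (H := dominant_derive_remainder d (RtoC x) (RtoC y) (entire_abs _ He) Hdom).
rewrite !CP_real, !Cmod_R, <- !RtoC_minus, <- RtoC_mult, <- RtoC_minus, !Cmod_R in H.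
rewrite (Rabs_right x), (Rabs_right y), (Rabs_left (d 1%nat)), (Rabs_left (x - y)) in H by lra.
assert (H1 : Rabs (PSeries d x - PSeries d y - d 1%nat * (x - y)) < - d 1%nat * - (x - y)).
{ apply H; try lra. intro E. apply RtoC_inj in E. lra. }
apply Rabs_def2 in H1. unfold w_real'. fold d. nra.
Qed.

(** If [w'(1) < 0] then [w'] vanishes inside (0, 1), where [w] turns back on
    itself and takes some real value twice. *)
Lemma univalent_w_real' a nu : 0 < a -> - (3 / 4) < nu -> univalent (w a nu) ->
  0 <= w_real' a nu 1.
Proof.
intros Ha Hn [_ Hinj]. apply Rnot_lt_le. intro Hneg.
assert (Hri : forall x y, 0 <= x < 1 -> 0 <= y < 1 -> w_real a nu x = w_real a nu y -> x = y).
{ intros x y Hx Hy E. apply RtoC_inj. apply Hinj; unfold disk;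
    try (rewrite Cmod_R, Rabs_right; lra). now rewrite !w_eq_w_real, E. }
assert (Hcont : continuity (w_real a nu)).
{ intro x. apply derivable_continuous_pt. eexists. rewrite <- is_derive_Reals.
  now apply is_derive_w_real. }
destruct (IVT (fun x => - w_real' a nu x) 0 1) as [x0 [Hx0 Hz]].
{ now apply continuity_opp, continuity_w_real'. }
{ lra. } { rewrite w_real'_0; lra. } { lra. }
assert (x0 <> 0) by (intros ->; rewrite w_real'_0 in Hz; lra).
assert (x0 <> 1) by (intros ->; lra).
set (x1 := (x0 + 1) / 2).
assert (Hlt : w_real a nu x1 < w_real a nu x0).
{ destruct (MVT_cor2 (w_real a nu) (w_real' a nu) x0 x1) as (c & Hc & Hc').
  - unfold x1; lra.
  - intros c _. rewrite <- is_derive_Reals. now apply is_derive_w_real.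
  - unfold x1 in *. assert (w_real' a nu c < w_real' a nu x0)
      by (apply w_real'_decreasing; lra). nra. }
assert (Hw0 := w_real_0 a nu).
assert (Hopp : forall l, continuity (fun x => w_real a nu x - l)).
{ intro l. apply continuity_minus; [assumption|]. apply continuity_const. intros ? ?; reflexivity. }
destruct (Rle_lt_dec 0 (w_real a nu x1)) as [Hp|Hp].
- destruct (IVT_cor (fun x => w_real a nu x - w_real a nu x1) 0 x0) as [y [Hy Ey]].
  + apply Hopp.
  + lra.
  + rewrite Hw0. nra.
  + assert (y = x1) by (apply Hri; unfold x1 in *; lra). unfold x1 in *; lra.
- destruct (Rle_lt_dec (w_real a nu x0) 0) as [Hq|Hq].
  +
    (* then [w] is already nonpositive at [x0], although it increases from [w 0 = 0] *)
    destruct (MVT_cor2 (w_real a nu) (w_real' a nu) 0 x0) as (c & Hc & Hc').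
    * lra.
    * intros c _. rewrite <- is_derive_Reals. now apply is_derive_w_real.
    * assert (w_real' a nu x0 < w_real' a nu c) by (apply w_real'_decreasing; lra). nra.
  + destruct (IVT_cor (fun x => w_real a nu x - 0) x0 x1) as [y [Hy Ey]].
    * apply Hopp.
    * unfold x1; lra.
    * nra.
    * assert (y = 0) by (apply Hri; unfold x1 in *; lra). lra.
Qed.

(** * Bessel functions *)

Lemma BesselJ_eq nu y : 0 < nu + 1 -> 0 < y ->
  BesselJ nu y = Rpower (y / 2) nu / Gamma (nu + 1) * PSeries (bessel_coef nu) (y ^ 2).
Proof.
intros Hn Hy. unfold BesselJ, PSeries. rewrite <- Series_scal_l. apply Series_ext. intro n.
replace (nu + INR n + 1) with (nu + 1 + INR n) by ring. rewrite Gamma_rising by assumption.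
rewrite Rpower_plus.
replace (2 * INR n) with (INR (2 * n)) by (rewrite mult_INR; simpl; ring).
rewrite Rpower_pow by lra. unfold bessel_coef.
replace ((y / 2) ^ (2 * n)) with ((y ^ 2) ^ n / 4 ^ n).
- pose proof (Gamma_pos (nu + 1) Hn). pose proof (rising_pos (nu + 1) n Hn).
  pose proof (INR_fact_neq_0 n). assert (4 ^ n <> 0) by (apply pow_nonzero; lra).
  field. repeat split; try assumption; lra.
- rewrite pow_mult. unfold Rdiv. rewrite <- pow_inv, <- Rpow_mult_distr. f_equal. field.
Qed.

Lemma theta_PSeries a x : entire a -> PSeries (theta a) x = x * PSeries (PS_derive a) x.
Proof.
intro Ha. rewrite PSeries_decr_1_aux by (unfold theta; simpl; ring). reflexivity.
Qed.

Lemma PSeries_w_coef a nu x : 0 < a -> - (3 / 4) < nu ->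
  PSeries (w_coef a nu) x =
  PSeries (bessel_coef nu) x + 2 / a * PSeries (theta (bessel_coef nu)) x.
Proof.
intros Ha Hn. assert (He := entire_bessel_coef nu Hn).
unfold PSeries. rewrite <- Series_scal_l, <- Series_plus.
- apply Series_ext. intro n. rewrite w_coef_bessel by lra. ring.
- now apply ex_series_entire.
- now apply ex_series_scal_R, ex_series_entire, entire_theta.
Qed.

(** With [P] the sum of [bessel_coef], [J_nu y] is a multiple of [(y / 2)^nu P (y^2)].
    So [y J_nu' y] is the same multiple of [(y / 2)^nu (nu P x + 2 x P' x)] at
    [x = y^2], and [x P'] is the sum of [theta bessel_coef]. *)
Lemma w_eq_Dini a nu x : 0 < a -> - (3 / 4) < nu -> 0 < x ->
  w a nu (RtoC x) =
     RtoC (Rpower 2 nu / a * Gamma (nu + 1) * Rpower x (1 - nu / 2)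
           * ((a - nu) * BesselJ nu (sqrt x)
              + sqrt x * Derive (BesselJ nu) (sqrt x))).
Proof.
intros Ha Hn Hx. rewrite w_eq_mul, CP_real, <- RtoC_mult by assumption. f_equal.
rewrite PSeries_w_coef by assumption.
assert (He := entire_bessel_coef nu Hn).
set (y := sqrt x). assert (Hy : 0 < y) by now apply sqrt_lt_R0.
assert (Hy2 : y ^ 2 = x) by (unfold y; simpl; rewrite Rmult_1_r; apply sqrt_sqrt; lra).
set (P := PSeries (bessel_coef nu)). set (K := / Gamma (nu + 1)).
assert (HG := Gamma_pos (nu + 1) ltac:(lra)).
assert (HD : is_derive (BesselJ nu) y
  (K * (/ 2 * (nu * Rpower (y / 2) (nu - 1)) * P (y ^ 2)
   + Rpower (y / 2) nu * (2 * y * PSeries (PS_derive (bessel_coef nu)) (y ^ 2))))).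
{ apply is_derive_ext_loc with (fun y => K * (Rpower (y / 2) nu * P (y ^ 2))).
  - exists (mkposreal y Hy). intros z Hz.
    apply Rabs_def2 in Hz. unfold minus, plus, opp in Hz; simpl in Hz.
    rewrite BesselJ_eq by lra. unfold K, P. apply Rmult_eq_reg_l with (Gamma (nu + 1)); [field|]; lra.
  - apply is_derive_scal. evar_last.
    { apply (is_derive_mult (fun y => Rpower (y / 2) nu) (fun y => P (y ^ 2))).
      - apply (is_derive_comp (fun t => Rpower t nu) (fun y => y / 2)).
        + apply is_derive_Rpower; lra.
        + auto_derive; [trivial|reflexivity].
      - apply (is_derive_comp P (fun y => y ^ 2)).
        + now apply is_derive_entire.
        + auto_derive; [trivial|reflexivity].
      - intros; apply Rmult_comm. }
    unfold plus, mult, scal; simpl; unfold mult; simpl. ring. }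
rewrite (is_derive_unique _ _ _ HD), BesselJ_eq by lra. rewrite theta_PSeries by assumption.
fold P. rewrite Hy2.
assert (E1 : Rpower (y / 2) nu = y / 2 * Rpower (y / 2) (nu - 1)).
{ rewrite <- (Rpower_1 (y / 2)) at 2 by lra. rewrite <- Rpower_plus. f_equal; ring. }
assert (E2 : Rpower 2 nu * Rpower x (1 - nu / 2) * Rpower (y / 2) nu = x).
{ unfold Rpower. rewrite <- !exp_plus. rewrite <- (exp_ln x) at 2 by assumption. f_equal.
  rewrite ln_div by lra. unfold y. rewrite <- Rpower_sqrt by assumption. unfold Rpower.
  rewrite ln_exp. field. }
rewrite <- E2 at 1.
replace (Rpower (y / 2) nu / Gamma (nu + 1)) with (K * Rpower (y / 2) nu)
  by (unfold K; field; lra).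
assert (E3 : y * (K * (/ 2 * (nu * Rpower (y / 2) (nu - 1)) * P x
   + Rpower (y / 2) nu * (2 * y * PSeries (PS_derive (bessel_coef nu)) x)))
  = K * Rpower (y / 2) nu * (nu * P x + 2 * x * PSeries (PS_derive (bessel_coef nu)) x)).
{ rewrite <- Hy2 at 4. rewrite E1. field. }
rewrite E3. unfold K. field. split; lra.
Qed.

(** Bessel's equation, summed at the point 1. *)
Lemma Series_bessel_ode nu : - (3 / 4) < nu ->
  Series (theta (theta (bessel_coef nu))) + nu * Series (theta (bessel_coef nu))
  = - / 4 * Series (bessel_coef nu).
Proof.
intros Hn. assert (He := entire_bessel_coef nu Hn).
assert (H : forall a, entire a -> ex_series a)
  by (intros b Hb; now apply ex_series_Rabs, entire_abs).
rewrite <- !Series_scal_l, <- Series_plus.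
- rewrite Series_incr_1_aux by (unfold theta; simpl; ring).
  apply Series_ext. intro n. unfold theta. rewrite bessel_coef_S, S_INR by lra.
  pose proof (pos_INR n). field. lra.
- apply H. now apply entire_theta, entire_theta.
- apply ex_series_scal_R, H. now apply entire_theta.
Qed.

Lemma bessel_coef_succ nu n : 0 < nu + 1 ->
  bessel_coef (nu + 1) n = - 4 * (nu + 1) * theta (bessel_coef nu) (S n).
Proof.
intro Hn. unfold theta. induction n as [|n IH].
- rewrite bessel_coef_S, !bessel_coef_0 by assumption. simpl. field. lra.
- rewrite (bessel_coef_S (nu + 1)), IH, (bessel_coef_S nu (S n)), !S_INR by lra.
  pose proof (pos_INR n). field. lra.
Qed.

Lemma w_real'_1 a nu : 0 < a -> - (3 / 4) < nu ->
  a * w_real' a nu 1 = a * Series (bessel_coef nu) + (a + 2) * Series (theta (bessel_coef nu))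
    + 2 * Series (theta (theta (bessel_coef nu))).
Proof.
intros Ha Hn. assert (He := entire_bessel_coef nu Hn).
assert (H : forall a, entire a -> ex_series a)
  by (intros b Hb; now apply ex_series_Rabs, entire_abs).
unfold w_real'. rewrite PSeries_1, <- !Series_scal_l, <- !Series_plus.
- apply Series_ext. intro n. unfold w_derive_coef, PS_derive_n.
  replace (n + 1)%nat with (S n) by lia. simpl PS_incr_1.
  rewrite w_coef_bessel, fact_simpl, mult_INR, S_INR by lra. unfold theta.
  pose proof (INR_fact_neq_0 n). field. split; [lra|assumption].
- apply (ex_series_plus (V := R_NormedModule)); apply ex_series_scal_R, H;
    [exact He|now apply entire_theta].
- now apply ex_series_scal_R, H, entire_theta, entire_theta.
- now apply ex_series_scal_R, H.
- now apply ex_series_scal_R, H, entire_theta.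
Qed.

(** [J_nu (1)] and [J_(nu+1) (1)] are multiples of the sums of [bessel_coef] and
    [theta bessel_coef]; the third sum, which occurs in [w'(1)], is eliminated by
    Bessel's equation. *)
Lemma nu_equation_iff a nu : 0 < a -> - (3 / 4) < nu ->
  nu_equation a nu <-> w_real' a nu 1 = 0.
Proof.
intros Ha Hn. unfold nu_equation.
assert (Hn1 : 0 < nu + 1) by lra. assert (HG := Gamma_pos (nu + 1) Hn1).
assert (E : (2 * a - 1) * BesselJ nu 1 - (a - 2 * nu + 2) * BesselJ (nu + 1) 1
   = 2 * Rpower (1 / 2) nu / Gamma (nu + 1) * (a * w_real' a nu 1)).
{ rewrite !BesselJ_eq by lra. rewrite pow1, !PSeries_1, (Gamma_succ (nu + 1)), w_real'_1 by lra.
  rewrite (Series_ext (bessel_coef (nu + 1)) _ (fun n => bessel_coef_succ nu n Hn1)).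
  rewrite Series_scal_l, <- (Series_incr_1_aux (theta (bessel_coef nu)))
    by (unfold theta; simpl; ring).
  assert (Ho := Series_bessel_ode nu Hn).
  replace (Series (theta (theta (bessel_coef nu)))) with
    (- / 4 * Series (bessel_coef nu) - nu * Series (theta (bessel_coef nu))) by lra.
  rewrite Rpower_plus, Rpower_1 by lra. field. lra. }
rewrite E. assert (0 < 2 * Rpower (1 / 2) nu / Gamma (nu + 1)).
{ apply Rdiv_lt_0_compat; [|assumption]. pose proof (exp_pos (nu * ln (1 / 2))).
  unfold Rpower. lra. }
split; intro H0.
- apply Rmult_integral in H0. destruct H0 as [H0|H0]; [lra|].
  apply Rmult_integral in H0. destruct H0; lra.
- rewrite H0. ring.
Qed.

(** * Dependence on [nu] *)

Lemma alternating_series_bounds (u : nat -> R) : (forall n, 0 <= u n) ->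
  (forall n, u (S n) <= u n) -> ex_series u ->
  u 0%nat - u 1%nat <= Series (fun n => (-1) ^ n * u n) <= u 0%nat.
Proof.
intros Hp Hd He.
assert (Hs : ex_series (fun n => (-1) ^ n * u n)).
{ apply ex_series_le_R with (2 := He). intro n.
  rewrite Rabs_mult, pow_1_abs, (Rabs_right (u n)); [lra|]. now apply Rle_ge. }
assert (H := alternated_series_ineq u (Series (fun n => (-1) ^ n * u n)) 0 Hd).
assert (H1 : Un_cv u 0) by (apply is_lim_seq_Reals; exact (ex_series_lim_0 _ He)).
specialize (H H1).
assert (H2 : Un_cv (fun N => sum_f_R0 (tg_alt u) N) (Series (fun n => (-1) ^ n * u n))).
{ apply is_series_Reals. apply Series_correct. exact Hs. }
specialize (H H2). simpl in H. unfold tg_alt in H. simpl in H. lra.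
Qed.

(** The [n]-th coefficient of [w'] is, up to sign, this weight divided by [(nu + 1)_n];
    only the latter depends on [nu]. *)
Definition w'_weight (a : R) (n : nat) : R :=
  (INR n + 1) * (2 * INR n + a) / (a * 4 ^ n * INR (fact n)).

Lemma w'_weight_pos a n : 0 < a -> 0 < w'_weight a n.
Proof.
intro Ha. pose proof (pos_INR n). pose proof (INR_fact_lt_0 n).
assert (0 < 4 ^ n) by (apply pow_lt; lra).
apply Rdiv_lt_0_compat; repeat apply Rmult_lt_0_compat; lra.
Qed.

Lemma w_derive_coef_1 a nu n : 0 < a -> 0 < nu + 1 ->
  w_derive_coef a nu 1 n = (-1) ^ n * (w'_weight a n * / rising (nu + 1) n).
Proof.
intros Ha Hn. unfold w_derive_coef, PS_derive_n, w'_weight.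
replace (n + 1)%nat with (S n) by lia. simpl PS_incr_1.
rewrite w_coef_bessel, fact_simpl, mult_INR, S_INR by lra. unfold theta, bessel_coef.
pose proof (INR_fact_neq_0 n). pose proof (rising_pos (nu + 1) n Hn).
assert (4 ^ n <> 0) by (apply pow_nonzero; lra).
field. repeat split; try assumption; lra.
Qed.

Lemma ex_series_w'_terms a nu : 0 < a -> - (3 / 4) < nu ->
  ex_series (fun n => w'_weight a n * / rising (nu + 1) n).
Proof.
intros Ha Hn. apply ex_series_ext_R with (2 := entire_abs _ (entire_w_derive_coef a nu 1 Ha Hn)).
intro n. rewrite w_derive_coef_1, Rabs_mult, pow_1_abs by lra.
rewrite Rabs_right; [ring|].
apply Rle_ge, Rmult_le_pos; [now apply Rlt_le, w'_weight_pos|].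
apply Rlt_le, Rinv_0_lt_compat, rising_pos. lra.
Qed.

Lemma w'_weight_S a n : 0 < a ->
  w'_weight a (S (S n)) <= 3 / 8 * w'_weight a (S n).
Proof.
intro Ha.
replace (w'_weight a (S (S n))) with (w'_weight a (S n) *
  ((INR n + 3) * (2 * INR n + 4 + a) / ((2 * INR n + 2 + a) * (4 * (INR n + 2) ^ 2)))).
- rewrite (Rmult_comm (3 / 8)). apply Rmult_le_compat_l; [now apply Rlt_le, w'_weight_pos|].
  pose proof (pos_INR n) as Hn. set (t := INR n) in *.
  apply Rle_div_l; [repeat apply Rmult_lt_0_compat; lra|].
  assert (E1 : (t + 1) * (2 * t + 4 + a) <= (2 * t + 2 + a) * (t + 2)) by nra.
  assert (E2 : (t + 3) <= 3 / 2 * (t + 1) * (t + 2)) by nra.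
  apply Rle_trans with (3 / 2 * (t + 1) * (t + 2) * (2 * t + 4 + a)).
  + apply Rmult_le_compat_r; lra.
  + replace (3 / 2 * (t + 1) * (t + 2) * (2 * t + 4 + a))
      with (3 / 2 * (t + 2) * ((t + 1) * (2 * t + 4 + a))) by ring.
    replace (3 / 8 * ((2 * t + 2 + a) * (4 * (t + 2) ^ 2)))
      with (3 / 2 * (t + 2) * ((2 * t + 2 + a) * (t + 2))) by field.
    apply Rmult_le_compat_l; lra.
- unfold w'_weight. rewrite (fact_simpl (S n)), mult_INR, !S_INR.
  pose proof (pos_INR n). assert (Hf := INR_fact_neq_0 (S n)).
  assert (4 ^ n <> 0) by (apply pow_nonzero; lra). simpl pow.
  field. repeat split; try assumption; lra.
Qed.

(** Without its first factor, [1 / (x)_(n+1)] still decreases in [x]. *)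
Lemma inv_rising_diff x y n : 0 < x -> x <= y ->
  (/ rising y (S n)) * (y - x) <= x * (/ rising x (S n) - / rising y (S n)).
Proof.
intros Hx Hxy.
assert (y * / rising y (S n) <= x * / rising x (S n)); [|lra].
induction n as [|n IH].
- simpl. right. field. lra.
- change (rising y (S (S n))) with (rising y (S n) * (y + INR (S n))).
  change (rising x (S (S n))) with (rising x (S n) * (x + INR (S n))).
  rewrite !Rinv_mult, <- !Rmult_assoc. pose proof (pos_INR (S n)).
  apply Rmult_le_compat; try assumption.
  + apply Rmult_le_pos; [lra|]. apply Rlt_le, Rinv_0_lt_compat, rising_pos; lra.
  + apply Rlt_le, Rinv_0_lt_compat; lra.
  + apply Rinv_le_contravar; lra.
Qed.

(** With [t = x + n + 1] and [d = y - x] the difference of [A / t] and [B / (t + d)] is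
    [(A - B) / t + B d / (t (t + d))], and by the previous lemma the second
    summand is at most the first. *)
Lemma inv_rising_diff_S x y n : 0 < x -> x <= y ->
  / rising x (S (S n)) - / rising y (S (S n))
  <= 2 / (x + INR (S n)) * (/ rising x (S n) - / rising y (S n)).
Proof.
intros Hx Hxy. assert (H := inv_rising_diff x y n Hx Hxy).
change (rising y (S (S n))) with (rising y (S n) * (y + INR (S n))).
change (rising x (S (S n))) with (rising x (S n) * (x + INR (S n))).
rewrite !Rinv_mult. set (A := / rising x (S n)) in *. set (B := / rising y (S n)) in *.
assert (HB : 0 < B) by (apply Rinv_0_lt_compat, rising_pos; lra).
assert (Ht : 1 <= INR (S n)) by (rewrite S_INR; pose proof (pos_INR n); lra).
set (t := INR (S n)) in *.
assert (HAB : 0 <= A - B) by nra.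
apply Rmult_le_reg_r with ((x + t) * (y + t)); [nra|].
replace ((A * / (x + t) - B * / (y + t)) * ((x + t) * (y + t)))
  with (A * (y + t) - B * (x + t)) by (field; lra).
replace (2 / (x + t) * (A - B) * ((x + t) * (y + t)))
  with (2 * (A - B) * (y + t)) by (field; lra).
assert (x * (A - B) <= (y + t) * (A - B)) by (apply Rmult_le_compat_r; lra).
nra.
Qed.

Lemma inv_rising_decreasing x y n : 0 < x -> x <= y -> / rising y n <= / rising x n.
Proof.
intros Hx Hxy. destruct n as [|n]; [simpl; lra|].
assert (H := inv_rising_diff x y n Hx Hxy).
assert (0 < / rising y (S n)) by (apply Rinv_0_lt_compat, rising_pos; lra). nra.
Qed.

(** As a function of [mu], [w'(1)] is an alternating series whose increments
    also alternate, each term being at most 3/5 of the one before; so an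
    increment lies between 2/5 of its first term and its first term. *)
Lemma w_real'_1_increment a m1 m2 : 0 < a -> - (3 / 4) < m1 -> m1 <= m2 ->
  2 / 5 * (w'_weight a 1 * (/ (m1 + 1) - / (m2 + 1)))
  <= w_real' a m2 1 - w_real' a m1 1
  <= w'_weight a 1 * (/ (m1 + 1) - / (m2 + 1)).
Proof.
intros Ha H1 H12.
set (D := fun n => w'_weight a n * (/ rising (m1 + 1) n - / rising (m2 + 1) n)).
assert (S1 := ex_series_w'_terms a m1 Ha H1).
assert (S2 := ex_series_w'_terms a m2 Ha ltac:(lra)).
assert (HD : ex_series D).
{ apply ex_series_ext_R with (2 := ex_series_minus (V := R_NormedModule) _ _ S1 S2).
  intro n. unfold D, plus, opp; simpl. ring. }
assert (HD0 : forall n, 0 <= D n).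
{ intro n. apply Rmult_le_pos; [now apply Rlt_le, w'_weight_pos|].
  assert (H := inv_rising_decreasing (m1 + 1) (m2 + 1) n ltac:(lra) ltac:(lra)). lra. }
assert (HDS : forall n, D (S (S n)) <= 3 / 5 * D (S n)).
{ intro n. unfold D.
  assert (Hd := inv_rising_decreasing (m1 + 1) (m2 + 1) (S n) ltac:(lra) ltac:(lra)).
  assert (Hd' := inv_rising_decreasing (m1 + 1) (m2 + 1) (S (S n)) ltac:(lra) ltac:(lra)).
  assert (Hi := inv_rising_diff_S (m1 + 1) (m2 + 1) n ltac:(lra) ltac:(lra)).
  assert (Hw := w'_weight_S a n Ha). assert (Hw0 := w'_weight_pos a (S n) Ha).
  set (u := / rising (m1 + 1) (S n) - / rising (m2 + 1) (S n)) in *.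
  assert (Hc : 2 / (m1 + 1 + INR (S n)) <= 8 / 5).
  { rewrite S_INR. pose proof (pos_INR n). apply Rle_div_l; lra. }
  apply Rle_trans with (3 / 8 * w'_weight a (S n) * (8 / 5 * u)); [|lra].
  apply Rmult_le_compat; [now apply Rlt_le, w'_weight_pos|lra|assumption|].
  apply Rle_trans with (1 := Hi). apply Rmult_le_compat_r; [unfold u; lra|assumption]. }
assert (E : w_real' a m2 1 - w_real' a m1 1 = Series (fun n => (-1) ^ n * D (S n))).
{ unfold w_real'. rewrite !PSeries_1, <- Series_minus.
  - rewrite Series_incr_1_aux.
    + apply Series_ext. intro n. rewrite !w_derive_coef_1 by lra. unfold D. simpl pow. ring.
    + rewrite !w_derive_coef_1 by lra. simpl. ring.
  - apply ex_series_Rabs, entire_abs, entire_w_derive_coef; lra.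
  - apply ex_series_Rabs, entire_abs, entire_w_derive_coef; lra. }
assert (B := alternating_series_bounds (fun n => D (S n))). simpl in B.
rewrite E. replace (w'_weight a 1 * (/ (m1 + 1) - / (m2 + 1))) with (D 1%nat).
- assert (H := HDS 0%nat).
  assert (B' : D 1%nat - D 2%nat <= Series (fun n => (-1) ^ n * D (S n)) <= D 1%nat).
  { apply B.
    - intro n. apply HD0.
    - intro n. assert (P := HD0 (S n)). assert (Q := HDS n). lra.
    - now apply ex_series_incr_1 in HD. }
  lra.
- unfold D. simpl rising. rewrite !Rplus_0_r, !Rmult_1_l. reflexivity.
Qed.

Lemma w_real'_1_increasing a m1 m2 : 0 < a -> - (3 / 4) < m1 -> m1 < m2 ->
  w_real' a m1 1 < w_real' a m2 1.
Proof.
intros Ha H1 H12. assert (H := w_real'_1_increment a m1 m2 Ha H1 ltac:(lra)).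
assert (/ (m2 + 1) < / (m1 + 1)) by (apply Rinv_lt_contravar; nra).
pose proof (w'_weight_pos a 1 Ha). nra.
Qed.

Lemma w_real'_1_lipschitz a m1 m2 : 0 < a -> - (3 / 4) < m1 -> - (3 / 4) < m2 ->
  Rabs (w_real' a m2 1 - w_real' a m1 1) <= 16 * w'_weight a 1 * Rabs (m2 - m1).
Proof.
assert (K : forall m1 m2, 0 < a -> - (3 / 4) < m1 -> m1 <= m2 ->
  Rabs (w_real' a m2 1 - w_real' a m1 1) <= 16 * w'_weight a 1 * Rabs (m2 - m1)).
{ clear. intros m1 m2 Ha H1 H12. assert (H := w_real'_1_increment a m1 m2 Ha H1 H12).
  assert (Hi : 0 <= / (m1 + 1) - / (m2 + 1) <= 16 * (m2 - m1)).
  { assert (/ (m2 + 1) <= / (m1 + 1)) by (apply Rinv_le_contravar; lra).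
    split; [lra|].
    replace (/ (m1 + 1) - / (m2 + 1)) with ((m2 - m1) / ((m1 + 1) * (m2 + 1))) by (field; lra).
    apply Rle_div_l; [nra|]. assert (1 <= 16 * ((m1 + 1) * (m2 + 1))) by nra. nra. }
  pose proof (w'_weight_pos a 1 Ha).
  assert (0 <= w'_weight a 1 * (/ (m1 + 1) - / (m2 + 1))) by (apply Rmult_le_pos; lra).
  rewrite !Rabs_right by lra. nra. }
intros Ha H1 H2. destruct (Rle_dec m1 m2) as [H|H].
- now apply K.
- rewrite (Rabs_minus_sym (w_real' _ _ _)), (Rabs_minus_sym m2). apply K; lra.
Qed.

Lemma w_real'_1_bounds a nu : 0 < a -> - (3 / 4) < nu ->
  1 - w'_weight a 1 * / (nu + 1) <= w_real' a nu 1
  <= 1 - w'_weight a 1 * / (nu + 1) + w'_weight a 2 * / ((nu + 1) * (nu + 2)).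
Proof.
intros Ha Hn. set (D := fun n => w'_weight a n * / rising (nu + 1) n).
assert (HD := ex_series_w'_terms a nu Ha Hn). fold D in HD.
assert (HD0 : forall n, 0 < D n).
{ intro n. apply Rmult_lt_0_compat; [now apply w'_weight_pos|].
  apply Rinv_0_lt_compat, rising_pos; lra. }
assert (HDS : forall n, D (S (S n)) <= D (S n)).
{ intro n. unfold D. apply Rmult_le_compat.
  - now apply Rlt_le, w'_weight_pos.
  - apply Rlt_le, Rinv_0_lt_compat, rising_pos; lra.
  - assert (H := w'_weight_S a n Ha). assert (H' := w'_weight_pos a (S n) Ha). lra.
  - apply Rinv_le_contravar; [apply rising_pos; lra|].
    change (rising (nu + 1) (S (S n))) with (rising (nu + 1) (S n) * (nu + 1 + INR (S n))).
    assert (H := rising_pos (nu + 1) (S n) ltac:(lra)).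
    rewrite S_INR. pose proof (pos_INR n). nra. }
assert (B := alternating_series_bounds (fun n => D (S n)) (fun n => Rlt_le _ _ (HD0 (S n))) HDS).
assert (HD' := HD). apply ex_series_incr_1 in HD'. specialize (B HD').
assert (E : w_real' a nu 1 = 1 - Series (fun n => (-1) ^ n * D (S n))).
{ unfold w_real'. rewrite PSeries_1, Series_incr_1
    by now apply ex_series_Rabs, entire_abs, entire_w_derive_coef.
  rewrite w_derive_coef_1 by lra. unfold Rminus. rewrite <- Series_opp. f_equal.
  - unfold w'_weight. simpl. field. lra.
  - apply Series_ext. intro n. rewrite w_derive_coef_1 by lra. unfold D. simpl pow. ring. }
rewrite E. replace (w'_weight a 1 * / (nu + 1)) with (D 1%nat).
- replace (w'_weight a 2 * / ((nu + 1) * (nu + 2))) with (D 2%nat); [lra|].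
  unfold D. simpl. do 2 f_equal. ring.
- unfold D. simpl. do 2 f_equal. ring.
Qed.

Lemma unique_nu_a a : 0 < a ->
  exists nu_a, unique (fun mu => - (3 / 4) < mu /\ nu_equation a mu) nu_a.
Proof.
intro Ha. set (M := (2 + a) / a).
assert (HM : 0 < M) by (apply Rdiv_lt_0_compat; lra).
(* The first three terms of the alternating series show that the value at -7/10 is
   negative for every [a], the first two that the value at [M] is positive. *)
destruct (Ranalysis5.IVT_interv (fun m => w_real' a m 1) (-7 / 10) M) as [z [Hz Ez]].
- intros m Hm. intros eps Heps.
  set (K := 16 * w'_weight a 1). assert (HK : 0 < K) by (pose proof (w'_weight_pos a 1 Ha); unfold K; lra).
  exists (Rmin (1 / 20) (eps / K)). split.
  + apply Rmin_pos; [lra|now apply Rdiv_lt_0_compat].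
  + intros y [_ Hy]. simpl in *. unfold R_dist in *.
    assert (Hy1 := Rlt_le_trans _ _ _ Hy (Rmin_l _ _)).
    assert (Hy2 := Rlt_le_trans _ _ _ Hy (Rmin_r _ _)).
    apply Rabs_def2 in Hy1.
    apply Rle_lt_trans with (1 := w_real'_1_lipschitz a m y Ha ltac:(lra) ltac:(lra)).
    fold K. rewrite Rmult_comm. now apply Rlt_div_r.
- lra.
- apply Rle_lt_trans with (1 := proj2 (w_real'_1_bounds a (-7 / 10) Ha ltac:(lra))).
  unfold w'_weight. simpl.
  replace (1 - (1 + 1) * (2 * 1 + a) / (a * (4 * 1) * 1) * / (-7 / 10 + 1) +
    (1 + 1 + 1) * (2 * (1 + 1) + a) / (a * (4 * (4 * 1)) * (1 + 1)) * / ((-7 / 10 + 1) * (-7 / 10 + 2)))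
   with ((1 - 5 / 3 + 25 / 104) + (- 10 / 3 + 100 / 104) * / a) by (field; lra).
  assert (0 < / a) by now apply Rinv_0_lt_compat. nra.
- apply Rlt_le_trans with (2 := proj1 (w_real'_1_bounds a M Ha ltac:(lra))).
  assert (w'_weight a 1 * / (M + 1) < 1); [|lra].
  apply Rlt_div_l; [lra|]. unfold w'_weight, M. simpl.
  replace ((1 + 1) * (2 * 1 + a) / (a * (4 * 1) * 1)) with (/ 2 * ((2 + a) / a)) by (field; lra).
  fold M. lra.
- exists z. split.
  + split; [lra|]. apply nu_equation_iff; auto; lra.
  + intros y [Hy Ey]. apply nu_equation_iff in Ey; try assumption.
    destruct (Rtotal_order z y) as [H|[H|H]]; [exfalso|assumption|exfalso].
    * assert (H' := w_real'_1_increasing a z y Ha ltac:(lra) H). lra.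
    * assert (H' := w_real'_1_increasing a y z Ha Hy H). lra.
Qed.

(** * Formal power series *)

Declare Scope seq_scope.
Delimit Scope seq_scope with S.

Definition seq_cst (c : R) (n : nat) : R := match n with O => c | S _ => 0 end.
Definition seq_X (n : nat) : R := match n with S O => 1 | _ => 0 end.
Definition seq_add (a b : nat -> R) (n : nat) : R := a n + b n.
Definition seq_opp (a : nat -> R) (n : nat) : R := - a n.
Definition seq_sub (a b : nat -> R) (n : nat) : R := a n - b n.
Definition seq_mul : (nat -> R) -> (nat -> R) -> nat -> R := PS_mult.

Notation "a + b" := (seq_add a b) : seq_scope.
Notation "- a" := (seq_opp a) : seq_scope.
Notation "a - b" := (seq_sub a b) : seq_scope.
Notation "a * b" := (seq_mul a b) : seq_scope.

Lemma seq_mul_0 a b : (a * b)%S 0%nat = a 0%nat * b 0%nat.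
Proof. reflexivity. Qed.

Lemma seq_mul_S a b n :
  (a * b)%S (S n) = a 0%nat * b (S n) + ((fun k => a (S k)) * b)%S n.
Proof. unfold seq_mul, PS_mult. rewrite decomp_sum by lia. reflexivity. Qed.

Lemma seq_mul_ext a b a' b' n : (forall k, (k <= n)%nat -> a k = a' k) ->
  (forall k, (k <= n)%nat -> b k = b' k) -> (a * b)%S n = (a' * b')%S n.
Proof.
intros Ha Hb. apply sum_eq. intros k Hk. rewrite Ha, Hb; [reflexivity|lia|lia].
Qed.

Lemma seq_mul_add_l a b c : ((a + b) * c = a * c + b * c)%S.
Proof.
apply functional_extensionality. intro n. unfold seq_mul, PS_mult, seq_add.
rewrite <- sum_plus. apply sum_eq. intros; ring.
Qed.

Lemma seq_mul_scal_l x a b n : ((fun k => x * a k)%R * b)%S n = x * (a * b)%S n.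
Proof.
unfold seq_mul, PS_mult. rewrite scal_sum. apply sum_eq. intros; ring.
Qed.

Lemma seq_mul_tl a b n :
  (a * b)%S (S n) = (a * (fun k => b (S k)))%S n + a (S n) * b 0%nat.
Proof.
revert a. induction n as [|n IH]; intro a.
- rewrite seq_mul_S, !seq_mul_0. ring.
- rewrite seq_mul_S, IH, (seq_mul_S a). ring.
Qed.

Lemma seq_mul_comm a b : (a * b = b * a)%S.
Proof.
apply functional_extensionality. intro n. revert a.
induction n as [|n IH]; intro a; [rewrite !seq_mul_0; ring|].
rewrite seq_mul_S, seq_mul_tl, IH. ring.
Qed.

Lemma seq_mul_assoc a b c : (a * (b * c) = (a * b) * c)%S.
Proof.
apply functional_extensionality. intro n. revert a.
induction n as [|n IH]; intro a; [rewrite !seq_mul_0; ring|].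
rewrite (seq_mul_S a), !(seq_mul_S _ c), IH, seq_mul_0.
replace (fun k => (a * b)%S (S k))
  with ((fun k => a 0%nat * b (S k))%R + (fun k => a (S k)) * b)%S
  by (apply functional_extensionality; intro k; now rewrite seq_mul_S).
rewrite seq_mul_add_l. unfold seq_add. rewrite seq_mul_scal_l. ring.
Qed.

Lemma seq_cst_mul c a n : (seq_cst c * a)%S n = c * a n.
Proof.
destruct n as [|n]; [reflexivity|]. rewrite seq_mul_S.
change (fun k => seq_cst c (S k)) with (fun _ : nat => 0).
replace (((fun _ => 0) * a)%S n) with 0; [simpl; ring|].
symmetry. apply sum_eq_R0. intros; ring.
Qed.

Lemma seq_X_mul_S a n : (seq_X * a)%S (S n) = a n.
Proof.
rewrite seq_mul_S. change (fun k => seq_X (S k)) with (fun k => match k with O => 1 | _ => 0 end).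
change (fun k => match k with O => 1 | _ => 0 end) with (seq_cst 1).
rewrite seq_cst_mul. simpl. ring.
Qed.

Lemma seq_ring_theory :
  ring_theory (seq_cst 0) (seq_cst 1) seq_add seq_mul seq_sub seq_opp (@eq (nat -> R)).
Proof.
split; intros; try (apply functional_extensionality; intro n);
  try (unfold seq_add, seq_sub, seq_opp; ring).
- unfold seq_add. destruct n; simpl; ring.
- rewrite seq_cst_mul. ring.
- now rewrite seq_mul_comm.
- now rewrite seq_mul_assoc.
- now rewrite seq_mul_add_l.
- unfold seq_add, seq_opp, seq_cst. destruct n; ring.
Qed.

Add Ring seq_ring : seq_ring_theory.

Lemma theta_mul a b : theta (a * b)%S = (theta a * b + a * theta b)%S.
Proof.
apply functional_extensionality. intro n. unfold theta, seq_add, seq_mul, PS_mult.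
rewrite <- sum_plus, scal_sum. apply sum_eq. intros k Hk.
rewrite minus_INR by assumption. ring.
Qed.

Lemma theta_opp a : theta (- a)%S = (- theta a)%S.
Proof. apply functional_extensionality. intro n. unfold theta, seq_opp. ring. Qed.

Lemma theta_sub a b : theta (a - b)%S = (theta a - theta b)%S.
Proof. apply functional_extensionality. intro n. unfold theta, seq_sub. ring. Qed.

Lemma theta_cst c : theta (seq_cst c) = seq_cst 0.
Proof.
apply functional_extensionality. intro n. unfold theta. destruct n; simpl; ring.
Qed.

(** Each coefficient of an inverse needs all the earlier ones, which are carried
    along as a function; its values beyond index [n] are junk. *)
Fixpoint seq_inv_upto (a : nat -> R) (n : nat) : nat -> R :=
  match n with
  | O => fun _ => 1
  | S m => fun k => if (k <=? m)%nat then seq_inv_upto a m k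
                    else - ((fun k => a (S k)) * seq_inv_upto a m)%S m
  end.

Definition seq_inv (a : nat -> R) (n : nat) : R := seq_inv_upto a n n.

Lemma seq_inv_upto_eq a n k : (k <= n)%nat -> seq_inv_upto a n k = seq_inv a k.
Proof.
induction n as [|n IH]; intro H.
- now replace k with 0%nat by lia.
- destruct (Nat.eq_dec k (S n)) as [->|E]; [reflexivity|].
  cbn [seq_inv_upto]. rewrite (proj2 (Nat.leb_le k n)) by lia. apply IH. lia.
Qed.

Lemma seq_inv_S a n : seq_inv a (S n) = - ((fun k => a (S k)) * seq_inv a)%S n.
Proof.
unfold seq_inv at 1. cbn [seq_inv_upto]. rewrite (proj2 (Nat.leb_gt (S n) n)) by lia.
f_equal. apply seq_mul_ext; intros k Hk; [reflexivity|now apply seq_inv_upto_eq].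
Qed.

Lemma seq_mul_inv a : a 0%nat = 1 -> (a * seq_inv a)%S = seq_cst 1.
Proof.
intro H. apply functional_extensionality. intros [|n].
- rewrite seq_mul_0, H. unfold seq_inv; simpl. ring.
- rewrite seq_mul_S, H, seq_inv_S. simpl. ring.
Qed.

Lemma sum_nonneg f n : (forall k, (k <= n)%nat -> 0 <= f k) -> 0 <= sum_f_R0 f n.
Proof.
intro H. replace 0 with (sum_f_R0 (fun _ => 0) n) by (now apply sum_eq_R0).
now apply sum_Rle.
Qed.

Lemma seq_mul_nonneg a b n : (forall k, (k <= n)%nat -> 0 <= a k) ->
  (forall k, (k <= n)%nat -> 0 <= b k) -> 0 <= (a * b)%S n.
Proof.
intros Ha Hb. apply sum_nonneg. intros k Hk. apply Rmult_le_pos; [apply Ha|apply Hb]; lia.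
Qed.

(** * The logarithmic derivative *)

(** [- theta psi / psi] for the normalized Bessel function [psi]. *)
Definition bessel_logder (nu : R) : nat -> R :=
  (- (theta (bessel_coef nu) * seq_inv (bessel_coef nu)))%S.

Lemma bessel_ode nu : 0 < nu + 1 ->
  (theta (theta (bessel_coef nu)) + seq_cst nu * theta (bessel_coef nu)
   = - (seq_cst (/ 4) * (seq_X * bessel_coef nu)))%S.
Proof.
intro Hn. apply functional_extensionality. intros [|n]; unfold seq_add, seq_opp;
  rewrite !seq_cst_mul.
- rewrite seq_mul_0. unfold theta. simpl. ring.
- rewrite seq_X_mul_S. unfold theta. rewrite bessel_coef_S, S_INR by assumption.
  pose proof (pos_INR n). field. lra.
Qed.

Lemma theta_bessel_logder nu :
  theta (bessel_coef nu) = (- (bessel_logder nu * bessel_coef nu))%S.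
Proof.
assert (H := seq_mul_inv _ (bessel_coef_0 nu)). unfold bessel_logder.
set (p := bessel_coef nu) in *. set (q := seq_inv p) in *. set (t := theta p).
replace (- (- (t * q) * p))%S with (t * (p * q))%S by ring. rewrite H. ring.
Qed.

(** Bessel's equation turns into a Riccati equation whose right-hand side has
    positive coefficients: this is the source of all positivity below. *)
Lemma bessel_riccati nu : 0 < nu + 1 ->
  (theta (bessel_logder nu) + seq_cst nu * bessel_logder nu
   = seq_cst (/ 4) * seq_X + bessel_logder nu * bessel_logder nu)%S.
Proof.
intro Hn. assert (Ho := bessel_ode nu Hn). assert (Ht := theta_bessel_logder nu).
assert (Hi := seq_mul_inv _ (bessel_coef_0 nu)).
rewrite Ht, theta_opp, theta_mul, Ht in Ho.
set (p := bessel_coef nu) in *. set (v := bessel_logder nu) in *. set (q := seq_inv p) in *.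
set (dv := theta v) in *. set (k := seq_cst nu) in *. set (f := seq_cst (/ 4)) in *.
assert (E : ((dv + k * v - (f * seq_X + v * v)) * p = seq_cst 0)%S).
{ transitivity (- (- (dv * p + v * - (v * p)) + k * - (v * p)) - f * (seq_X * p))%S; [ring|].
  rewrite Ho. ring. }
transitivity ((dv + k * v - (f * seq_X + v * v)) * p * q + (f * seq_X + v * v)
  + (dv + k * v - (f * seq_X + v * v)) * (seq_cst 1 - p * q))%S; [ring|].
rewrite E, Hi. ring.
Qed.

Lemma bessel_logder_0 nu : bessel_logder nu 0 = 0.
Proof. unfold bessel_logder, seq_opp. rewrite seq_mul_0. unfold theta. simpl. ring. Qed.

Lemma bessel_logder_S nu n : 0 < nu + 1 ->
  (INR (S n) + nu) * bessel_logder nu (S n) =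
  match n with O => / 4 | S _ => 0 end
  + ((fun k => bessel_logder nu (S k)) * bessel_logder nu)%S n.
Proof.
intro Hn. assert (H := f_equal (fun a => a (S n)) (bessel_riccati nu Hn)).
cbv beta in H. unfold seq_add in H. rewrite !seq_cst_mul, (seq_mul_S (bessel_logder nu)) in H.
rewrite bessel_logder_0 in H. unfold theta in H.
rewrite Rmult_plus_distr_r, H. destruct n; simpl; ring.
Qed.

(** In the Riccati recursion the convolution has [n] nonzero products, each at most
    [r^(n+1)], and is divided by [n + 1 + nu >= n]. *)
Lemma bessel_logder_bounds nu : 0 < nu + 1 -> forall n,
  0 <= bessel_logder nu (S n) <= (/ (4 * (nu + 1))) ^ S n.
Proof.
intro Hn. set (r := / (4 * (nu + 1))).
assert (Hr : 0 < r) by (apply Rinv_0_lt_compat; lra).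
set (v := bessel_logder nu).
assert (Hall : forall n k, (k <= n)%nat -> 0 <= v (S k) <= r ^ S k).
{ induction n as [|n IH]; intros k Hk.
  - replace k with 0%nat by lia. assert (H := bessel_logder_S nu 0 Hn).
    rewrite seq_mul_0 in H. fold v in H. replace (v 0%nat) with 0 in H by (symmetry; apply bessel_logder_0).
    simpl in H. replace (v 1%nat) with r.
    + simpl. lra.
    + unfold r. apply Rmult_eq_reg_l with (1 + nu); [|lra]. rewrite H. field. lra.
  - destruct (Nat.eq_dec k (S n)) as [->|E]; [|apply IH; lia].
    assert (H := bessel_logder_S nu (S n) Hn). cbv iota in H. fold v in H.
    unfold seq_mul, PS_mult in H. simpl sum_f_R0 in H.
    replace (n - n)%nat with 0%nat in H by lia.
    replace (v 0%nat) with 0 in H by (symmetry; apply bessel_logder_0).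
    rewrite Rmult_0_r, Rplus_0_r, Rplus_0_l in H.
    set (T := sum_f_R0 _ n) in H.
    assert (HT : 0 <= T <= r ^ S (S n) * INR (S n)).
    { unfold T. split.
      - apply sum_nonneg. intros i Hi. replace (match i with O => S n | S l => n - l end)%nat with (S (n - i)).
        + apply Rmult_le_pos; apply IH; lia.
        + destruct i; lia.
      - rewrite <- sum_cte. apply sum_Rle. intros i Hi.
        replace (match i with O => S n | S l => n - l end)%nat with (S (n - i)) by (destruct i; lia).
        replace (r ^ S (S n)) with (r ^ S i * r ^ S (n - i))
          by (rewrite <- pow_add; f_equal; lia).
        apply Rmult_le_compat; apply IH; lia. }
    assert (HS := S_INR (S n)). assert (P := pos_INR (S n)).
    assert (Hc : 0 < INR (S (S n)) + nu) by lra.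
    assert (0 <= r ^ S (S n)) by (apply pow_le; lra).
    split.
    + apply Rmult_le_reg_l with (1 := Hc). rewrite H. lra.
    + apply Rmult_le_reg_l with (1 := Hc). rewrite H.
      apply Rle_trans with (1 := proj2 HT). rewrite Rmult_comm.
      apply Rmult_le_compat_r; lra. }
intro n. now apply (Hall n).
Qed.

Definition dini_inv (b nu : R) : nat -> R :=
  seq_inv (seq_cst 1 - seq_cst b * bessel_logder nu)%S.

(** With [phi = w / z = psi (1 - b v)] and [b = 2 / a], the series
    [- theta phi / phi], so that [z w' / w = 1 - w_logder]. *)
Definition w_logder (a nu : R) : nat -> R :=
  (bessel_logder nu
   + seq_cst (2 / a) * (theta (bessel_logder nu) * dini_inv (2 / a) nu))%S.

Lemma dini_inv_eq b nu :
  ((seq_cst 1 - seq_cst b * bessel_logder nu) * dini_inv b nu = seq_cst 1)%S.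
Proof.
apply seq_mul_inv. unfold seq_sub. rewrite seq_cst_mul, bessel_logder_0. simpl. ring.
Qed.

Lemma dini_inv_rec b nu :
  dini_inv b nu = (seq_cst 1 + seq_cst b * (bessel_logder nu * dini_inv b nu))%S.
Proof. rewrite <- (dini_inv_eq b nu). ring. Qed.

(** Nonnegativity is clear from the recursion [Y = 1 + b v Y]. The upper bound is
    where [a >= 2 / (4 nu + 3)] enters: for [b = 2 / a] and [r = 1 / (4 (nu + 1))] it
    says [b r <= 1 - r], so that the coefficients of [b v], being at most [b r^n],
    sum up to at most 1. *)
Lemma dini_inv_bounds b nu : 0 < b -> 0 < nu + 1 -> b + 1 <= 4 * (nu + 1) ->
  forall n, 0 <= dini_inv b nu n <= 1.
Proof.
intros Hb Hn Hbn. set (r := / (4 * (nu + 1))).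
assert (Hr : 0 < r) by (apply Rinv_0_lt_compat; lra).
assert (Hbr : b * r <= 1 - r).
{ assert ((b + 1) * r <= 1); [|lra]. unfold r.
  apply Rmult_le_reg_r with (4 * (nu + 1)); [lra|].
  rewrite Rmult_assoc, Rinv_l by lra. lra. }
assert (Hgeo : forall n, b * sum_f_R0 (fun k => r ^ S k) n <= 1 - r ^ S n).
{ induction n as [|n IH]; [simpl; lra|]. rewrite tech5, Rmult_plus_distr_l.
  assert (b * r ^ S (S n) <= (1 - r) * r ^ S n).
  { simpl (r ^ S (S n)). rewrite <- Rmult_assoc. apply Rmult_le_compat_r; [apply (pow_le r (S n))|]; lra. }
  simpl in *. lra. }
set (y := dini_inv b nu).
assert (H0 : y 0%nat = 1) by reflexivity.
assert (HS : forall n, y (S n) = b * ((fun k => bessel_logder nu (S k)) * y)%S n).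
{ intro n. unfold y at 1. rewrite dini_inv_rec. unfold seq_add.
  rewrite seq_cst_mul, seq_mul_S, bessel_logder_0. fold y. simpl. ring. }
assert (Hall : forall n k, (k <= n)%nat -> 0 <= y k <= 1).
{ induction n as [|n IH]; intros k Hk.
  - replace k with 0%nat by lia. rewrite H0. lra.
  - destruct (Nat.eq_dec k (S n)) as [->|E]; [|apply IH; lia].
    rewrite HS. assert (Hv := bessel_logder_bounds nu Hn). fold r in Hv. split.
    + apply Rmult_le_pos; [lra|]. apply seq_mul_nonneg; intros; [apply Hv|now apply IH].
    + apply Rle_trans with (b * sum_f_R0 (fun k => r ^ S k) n).
      * apply Rmult_le_compat_l; [lra|]. apply sum_Rle. intros i Hi.
        rewrite <- (Rmult_1_r (r ^ S i)).
        apply Rmult_le_compat; try apply Hv; apply IH; lia.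
      * assert (0 < r ^ S n) by now apply pow_lt. specialize (Hgeo n). lra. }
intro n. now apply (Hall n).
Qed.

Lemma w_logder_0 a nu : w_logder a nu 0 = 0.
Proof.
unfold w_logder, seq_add. rewrite seq_cst_mul, seq_mul_0, bessel_logder_0.
unfold theta. simpl. ring.
Qed.

(** The upper bound makes the series converge in the unit disk. *)
Lemma w_logder_bounds a nu : 0 < a -> 0 < nu + 1 -> 2 / a + 1 <= 4 * (nu + 1) ->
  forall n, 0 <= w_logder a nu n <= INR (S n).
Proof.
intros Ha Hn Han n. set (b := 2 / a) in *.
assert (Hb : 0 < b) by (apply Rdiv_lt_0_compat; lra).
assert (Hr : 0 < / (4 * (nu + 1)) <= 1).
{ split; [apply Rinv_0_lt_compat; lra|]. rewrite <- Rinv_1. apply Rinv_le_contravar; lra. }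
assert (Hv : forall k, 0 <= bessel_logder nu k <= 1).
{ intros [|k]; [rewrite bessel_logder_0; lra|].
  assert (H := bessel_logder_bounds nu Hn k).
  assert ((/ (4 * (nu + 1))) ^ S k <= 1 ^ S k) by (apply pow_incr; lra).
  rewrite pow1 in *. lra. }
assert (Hy := dini_inv_bounds b nu Hb Hn Han).
assert (Hrec := f_equal (fun c => c n) (dini_inv_rec b nu)). cbv beta in Hrec.
unfold seq_add in Hrec. rewrite seq_cst_mul in Hrec.
assert (P0 : 0 <= (theta (bessel_logder nu) * dini_inv b nu)%S n).
{ apply seq_mul_nonneg; intros k _; [|apply Hy].
  apply Rmult_le_pos; [apply pos_INR|apply Hv]. }
(* a factor [k <= n] inside the convolution can be replaced by [n] *)
assert (P1 : (theta (bessel_logder nu) * dini_inv b nu)%S n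
   <= INR n * (bessel_logder nu * dini_inv b nu)%S n).
{ unfold seq_mul, PS_mult. rewrite scal_sum. apply sum_Rle. intros k Hk. unfold theta.
  replace (INR k * bessel_logder nu k * dini_inv b nu (n - k)%nat)
    with (bessel_logder nu k * dini_inv b nu (n - k)%nat * INR k) by ring.
  apply Rmult_le_compat_l; [|now apply le_INR]. apply Rmult_le_pos; [apply Hv|apply Hy]. }
assert (P2 : b * (bessel_logder nu * dini_inv b nu)%S n <= 1).
{ assert (0 <= seq_cst 1 n) by (destruct n; simpl; lra). specialize (Hy n). lra. }
unfold w_logder, seq_add. rewrite seq_cst_mul. fold b. rewrite S_INR.
specialize (Hv n). pose proof (pos_INR n). split.
- assert (0 <= b * (theta (bessel_logder nu) * dini_inv b nu)%S n)
    by (apply Rmult_le_pos; lra). lra.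
- assert (b * (theta (bessel_logder nu) * dini_inv b nu)%S n
     <= b * (INR n * (bessel_logder nu * dini_inv b nu)%S n))
    by (apply Rmult_le_compat_l; lra).
  assert (INR n * (b * (bessel_logder nu * dini_inv b nu)%S n) <= INR n * 1)
    by (apply Rmult_le_compat_l; lra).
  lra.
Qed.

(** Logarithmic differentiation of [phi = psi (1 - b v)]. *)
Lemma theta_w_coef a nu : 0 < a -> 0 < nu + 1 ->
  theta (w_coef a nu) = (- (w_coef a nu * w_logder a nu))%S.
Proof.
intros Ha Hn.
assert (Ht := theta_bessel_logder nu). assert (Hi := dini_inv_eq (2 / a) nu).
assert (E : w_coef a nu =
  (bessel_coef nu * (seq_cst 1 - seq_cst (2 / a) * bessel_logder nu))%S).
{ transitivity (bessel_coef nu + seq_cst (2 / a) * theta (bessel_coef nu))%S.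
  - apply functional_extensionality. intro n. unfold seq_add.
    rewrite seq_cst_mul. now apply w_coef_bessel.
  - rewrite Ht. ring. }
rewrite E, theta_mul, theta_sub, theta_mul, !theta_cst, Ht. unfold w_logder.
set (p := bessel_coef nu) in *. set (v := bessel_logder nu) in *.
set (y := dini_inv (2 / a) nu) in *. set (b := seq_cst (2 / a)) in *.
set (dv := theta v) in *.
transitivity (- (p * (seq_cst 1 - b * v) * v + b * (p * dv) * ((seq_cst 1 - b * v) * y)))%S;
  [rewrite Hi|]; ring.
Qed.

(** * The complex exponential *)

Definition cexp (z : C) : C := (exp (fst z) * cos (snd z), exp (fst z) * sin (snd z)).

Lemma cexp_plus x y : cexp (x + y)%C = (cexp x * cexp y)%C.
Proof.
apply C_eq; simpl; rewrite exp_plus; [rewrite cos_plus|rewrite sin_plus]; ring.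
Qed.

Lemma cexp_0 : cexp (RtoC 0) = RtoC 1.
Proof. apply C_eq; simpl; rewrite exp_0; [rewrite cos_0|rewrite sin_0]; ring. Qed.

Lemma cexp_R x : cexp (RtoC x) = RtoC (exp x).
Proof. apply C_eq; simpl; [rewrite cos_0|rewrite sin_0]; ring. Qed.

Lemma Cmod_cexp x : Cmod (cexp x) = exp (Re x).
Proof.
unfold Cmod, cexp; simpl.
replace (exp (fst x) * cos (snd x) * (exp (fst x) * cos (snd x) * 1)
  + exp (fst x) * sin (snd x) * (exp (fst x) * sin (snd x) * 1))
  with (exp (fst x) * exp (fst x) * (Rsqr (sin (snd x)) + Rsqr (cos (snd x))))
  by (unfold Rsqr; ring).
rewrite sin2_cos2, Rmult_1_r. apply sqrt_square. apply Rlt_le, exp_pos.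
Qed.

Lemma cexp_opp x : (cexp x * cexp (- x))%C = RtoC 1.
Proof. rewrite <- cexp_plus, <- cexp_0. f_equal. ring. Qed.

Lemma polar_unit x y : x ^ 2 + y ^ 2 = 1 -> exists t, cos t = x /\ sin t = y.
Proof.
intro H. assert (Hx : -1 <= x <= 1) by nra.
destruct (Rle_dec 0 y) as [Hy|Hy].
- exists (acos x). split; [now apply cos_acos|]. rewrite sin_acos by assumption.
  replace (1 - x²) with (y * y) by (unfold Rsqr; nra). now apply sqrt_square.
- exists (- acos x). rewrite cos_neg, sin_neg, sin_acos by assumption.
  split; [now apply cos_acos|].
  replace (1 - x²) with (- y * - y) by (unfold Rsqr; nra). rewrite sqrt_square; lra.
Qed.

Lemma clog_exists z : z <> RtoC 0 -> exists x, cexp x = z /\ Re x = ln (Cmod z).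
Proof.
intro Hz. assert (Hm : 0 < Cmod z) by now apply Cmod_gt_0.
destruct (polar_unit (Re z / Cmod z) (Im z / Cmod z)) as (t & Hc & Hs).
- assert (H := Cmod2_alt z). 
  replace ((Re z / Cmod z) ^ 2 + (Im z / Cmod z) ^ 2)
    with ((Re z ^ 2 + Im z ^ 2) / Cmod z ^ 2) by (field; lra).
  rewrite <- H. field. lra.
- exists (ln (Cmod z), t). split; [|reflexivity].
  apply C_eq; simpl; rewrite exp_ln by assumption.
  + rewrite Hc. unfold Re. field. lra.
  + rewrite Hs. unfold Im. field. lra.
Qed.

Lemma cexp_eq_1 x : cexp x = RtoC 1 -> exists k : Z, x = (0, 2 * (IZR k * PI)).
Proof.
intro H. assert (E := Cmod_cexp x). rewrite H, Cmod_1 in E.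
assert (Hr : Re x = 0) by (apply exp_inv; now rewrite exp_0).
assert (Hc : cos (Im x) = 1).
{ apply (f_equal Re) in H. simpl in H. unfold Re in Hr. rewrite Hr, exp_0 in H.
  unfold Im. lra. }
assert (Hs : sin (Im x / 2) = 0).
{ replace (Im x) with (2 * (Im x / 2)) in Hc by field. rewrite cos_2a_sin in Hc. nra. }
apply sin_eq_0_0 in Hs. destruct Hs as [k Hk]. exists k.
apply C_eq; simpl; [assumption|]. rewrite <- Hk. unfold Im. field.
Qed.

Lemma cexp_period (k : Z) : cexp (0, 2 * (IZR k * PI)) = RtoC 1.
Proof.
assert (Hs : sin (IZR k * PI) = 0) by (apply sin_eq_0_1; now exists k).
apply C_eq; simpl; rewrite exp_0.
- rewrite cos_2a_sin, Hs. ring.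
- rewrite sin_2a, Hs. ring.
Qed.

Lemma cexp_eq x y : cexp x = cexp y ->
  exists p, cexp p = RtoC 1 /\ x = (y + p)%C.
Proof.
intro H. destruct (cexp_eq_1 (x - y)%C) as [k Hk].
- unfold Cminus. rewrite cexp_plus, H. apply cexp_opp.
- exists (0, 2 * (IZR k * PI)). split; [apply cexp_period|]. rewrite <- Hk. ring.
Qed.

(** This is [sin^2 (y / 2) <= (y / 2)^2]. *)
Lemma one_minus_cos_le y : 2 * (1 - cos y) <= y ^ 2.
Proof.
assert (H : Rabs (sin (y / 2)) <= Rabs (y / 2)).
{ destruct (Rtotal_order (y / 2) 0) as [Hy|[Hy|Hy]].
  - rewrite <- Rabs_Ropp, <- sin_neg, <- (Rabs_Ropp (y / 2)).
    set (u := - (y / 2)) in *. assert (Hu : 0 < u) by (unfold u; lra).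
    assert (H1 := sin_lt_x u Hu). assert (H2 := SIN_bound u).
    rewrite (Rabs_right u) by lra. apply Rabs_le. split; [|lra].
    destruct (Rle_dec u PI) as [H3|H3].
    + assert (0 <= sin u) by (apply sin_ge_0; lra). lra.
    + pose proof PI2_1. lra.
  - rewrite Hy, sin_0. lra.
  - set (u := y / 2) in *.
    assert (H1 := sin_lt_x u Hy). assert (H2 := SIN_bound u).
    rewrite (Rabs_right u) by lra. apply Rabs_le. split; [|lra].
    destruct (Rle_dec u PI) as [H3|H3].
    + assert (0 <= sin u) by (apply sin_ge_0; lra). lra.
    + pose proof PI2_1. lra. }
apply Rsqr_le_abs_1 in H. unfold Rsqr in H.
replace (cos y) with (cos (2 * (y / 2))) by (f_equal; field).
rewrite cos_2a_sin. nra.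
Qed.

Lemma Cmod_cexp_sub_1 x : Re x <= 0 -> Cmod (cexp x - 1)%C <= Cmod x.
Proof.
intro Hx. apply Rsqr_incr_0_var; [|apply Cmod_ge_0].
rewrite !Rsqr_pow2, !Cmod2_alt. simpl. destruct x as [x y]. simpl in *.
assert (H1 := one_minus_cos_le y). assert (H2 := exp_pos x).
assert (H3 : exp x <= 1).
{ rewrite <- exp_0. destruct (Req_dec x 0) as [->|]; [lra|]. left. apply exp_increasing; lra. }
assert (H4 := exp_ineq1_le x). assert (H5 := sin2_cos2 y). unfold Rsqr in H5.
assert (H6 : (exp x - 1) ^ 2 <= x ^ 2) by nra.
assert (H7 : exp x * (2 * (1 - cos y)) <= 1 * y ^ 2).
{ apply Rmult_le_compat; try lra. assert (H := COS_bound y). lra. }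
replace ((exp x * cos y + - (1)) * ((exp x * cos y + - (1)) * 1)
   + (exp x * sin y + - 0) * ((exp x * sin y + - 0) * 1))
  with ((exp x - 1) ^ 2 + exp x * (2 * (1 - cos y))
    + exp x ^ 2 * (sin y * sin y + cos y * cos y - 1)) by ring.
rewrite H5. simpl in *. lra.
Qed.

(** On a left half plane [exp] is Lipschitz with its maximal modulus. *)
Lemma cexp_lipschitz x y r : 0 < r -> Re x <= ln r -> Re y <= ln r ->
  Cmod (cexp x - cexp y)%C <= r * Cmod (x - y)%C.
Proof.
assert (K : forall x y, Re x <= Re y -> Cmod (cexp x - cexp y)%C <= exp (Re y) * Cmod (x - y)%C).
{ clear. intros x y H.
  replace (cexp x - cexp y)%C with (cexp y * (cexp (x - y) - 1))%C.
  - rewrite Cmod_mult, Cmod_cexp. apply Rmult_le_compat_l; [apply Rlt_le, exp_pos|].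
    apply Cmod_cexp_sub_1. unfold Re in *. simpl. lra.
  - replace x with (y + (x - y))%C at 2 by ring. rewrite cexp_plus. ring. }
intros Hr Hx Hy.
assert (Hexp : forall t, t <= ln r -> exp t <= r).
{ intros t Ht. rewrite <- (exp_ln r) by assumption.
  destruct Ht as [Ht| ->]; [left; now apply exp_increasing|apply Rle_refl]. }
pose proof (Cmod_ge_0 (x - y)%C).
destruct (Rle_dec (Re x) (Re y)) as [H1|H1].
- apply Rle_trans with (1 := K x y H1). apply Rmult_le_compat_r; auto.
- replace (cexp x - cexp y)%C with (- (cexp y - cexp x))%C by ring.
  replace (x - y)%C with (- (y - x))%C in * by ring. rewrite !Cmod_opp in *.
  apply Rle_trans with (1 := K y x ltac:(lra)). apply Rmult_le_compat_r; auto.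
Qed.

(** * Exponentials of power series *)

Lemma Re_scal_term x z : Re (RtoC x * z)%C = x * Re z.
Proof. unfold Re; simpl. ring. Qed.

Lemma Im_scal_term x z : Im (RtoC x * z)%C = x * Im z.
Proof. unfold Im; simpl. ring. Qed.

Lemma CP_Re a z : Re (CP a z) = Series (fun n => a n * Re (z ^ n)%C).
Proof. unfold CP, CSeries, Re at 1. cbn [fst]. apply Series_ext. intro n. apply Re_scal_term. Qed.

Lemma CP_Im a z : Im (CP a z) = Series (fun n => a n * Im (z ^ n)%C).
Proof. unfold CP, CSeries, Im at 1. cbn [snd]. apply Series_ext. intro n. apply Im_scal_term. Qed.

Lemma Re_Cmult x y : Re (x * y)%C = Re x * Re y - Im x * Im y.
Proof. reflexivity. Qed.

Lemma Im_Cmult x y : Im (x * y)%C = Re x * Im y + Im x * Re y.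
Proof. reflexivity. Qed.

(** The Cauchy product, from four real ones. *)
Lemma CP_mul a b z : abs_summable a (Cmod z) -> abs_summable b (Cmod z) ->
  CP (a * b)%S z = (CP a z * CP b z)%C.
Proof.
intros Ha Hb. apply C_abs_summable_term in Ha. apply C_abs_summable_term in Hb.
assert (K : forall f : C -> R, (forall x w, f (RtoC x * w)%C = x * f w) ->
  (forall u, C_abs_summable u -> ex_series (fun n => Rabs (f (u n)))) ->
  ex_series (fun n => Rabs (a n * f (z ^ n)%C)) /\ ex_series (fun n => Rabs (b n * f (z ^ n)%C))).
{ intros f Hf Hs. split.
  - apply ex_series_ext_R with (2 := Hs _ Ha). intro n. now rewrite Hf.
  - apply ex_series_ext_R with (2 := Hs _ Hb). intro n. now rewrite Hf. }
destruct (K Re Re_scal_term ex_series_Re) as [A1 B1].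
destruct (K Im Im_scal_term ex_series_Im) as [A2 B2].
assert (M : forall u v, ex_series (fun n => Rabs (u n)) -> ex_series (fun n => Rabs (v n)) ->
   is_series (seq_mul u v) (Series u * Series v)).
{ intros u v Hu Hv. apply (is_series_mult u v); try assumption; now apply Series_correct, ex_series_Rabs. }
assert (MRR := M _ _ A1 B1). assert (MII := M _ _ A2 B2).
assert (MRI := M _ _ A1 B2). assert (MIR := M _ _ A2 B1).
apply C_eq.
- rewrite Re_Cmult, !CP_Re, !CP_Im.
  apply is_series_unique. apply is_series_ext with (2 := is_series_minus _ _ _ _ MRR MII).
  intro n. unfold minus, plus, opp; simpl. unfold seq_mul, PS_mult.
  change (sum_f_R0 (fun k => a k * Re (z ^ k)%C * (b (n - k)%nat * Re (z ^ (n - k))%C)) n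
   - sum_f_R0 (fun k => a k * Im (z ^ k)%C * (b (n - k)%nat * Im (z ^ (n - k))%C)) n
   = sum_f_R0 (fun k => a k * b (n - k)%nat) n * Re (z ^ n)%C).
  rewrite <- minus_sum, Rmult_comm, scal_sum. apply sum_eq. intros k Hk.
  replace (z ^ n)%C with (z ^ k * z ^ (n - k))%C
    by (rewrite <- Cpow_add_r; f_equal; lia).
  rewrite Re_Cmult. ring.
- rewrite Im_Cmult, !CP_Re, !CP_Im.
  apply is_series_unique. apply is_series_ext with (2 := is_series_plus _ _ _ _ MRI MIR).
  intro n. unfold minus, plus, opp; simpl. unfold seq_mul, PS_mult.
  change (sum_f_R0 (fun k => a k * Re (z ^ k)%C * (b (n - k)%nat * Im (z ^ (n - k))%C)) n
   + sum_f_R0 (fun k => a k * Im (z ^ k)%C * (b (n - k)%nat * Re (z ^ (n - k))%C)) n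
   = sum_f_R0 (fun k => a k * b (n - k)%nat) n * Im (z ^ n)%C).
  rewrite <- sum_plus, Rmult_comm, scal_sum. apply sum_eq. intros k Hk.
  replace (z ^ n)%C with (z ^ k * z ^ (n - k))%C
    by (rewrite <- Cpow_add_r; f_equal; lia).
  rewrite Im_Cmult. ring.
Qed.

Lemma CP_opp a z : CP (- a)%S z = (- CP a z)%C.
Proof.
apply C_eq.
- change (Re (- CP a z)%C) with (- Re (CP a z)). rewrite !CP_Re, <- Series_opp.
  apply Series_ext. intro n. unfold seq_opp. ring.
- change (Im (- CP a z)%C) with (- Im (CP a z)). rewrite !CP_Im, <- Series_opp.
  apply Series_ext. intro n. unfold seq_opp. ring.
Qed.

Lemma abs_summable_theta a r r' : 0 <= r < r' -> abs_summable a r' -> abs_summable (theta a) r.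
Proof.
intros Hr Ha. apply ex_series_incr_1.
assert (H : Rbar_lt (Rabs r) (CV_radius (PS_derive a))).
{ rewrite CV_radius_derive. apply abs_summable_CV_radius with r'; [assumption|].
  rewrite Rabs_right; lra. }
apply CV_disk_inside in H. apply ex_series_ext_R with (fun n => r * Rabs (PS_derive a n * r ^ n)).
- intro n. rewrite Rabs_mult, (Rabs_right (r ^ n)) by (apply Rle_ge, pow_le; lra).
  unfold theta, PS_derive. simpl (r ^ S n). ring.
- now apply ex_series_scal_R.
Qed.

(** Along a ray the calculus of real power series applies. *)
Lemma CP_ray a z t :
  CP a (RtoC t * z)%C =
  (PSeries (fun n => a n * Re (z ^ n)%C) t, PSeries (fun n => a n * Im (z ^ n)%C) t).
Proof.
apply C_eq.
- rewrite CP_Re. apply Series_ext. intro n. rewrite Cpow_mult_l, <- RtoC_pow, Re_scal_term. ring.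
- rewrite CP_Im. apply Series_ext. intro n. rewrite Cpow_mult_l, <- RtoC_pow, Im_scal_term. ring.
Qed.

Lemma PSeries_theta_ray (a : nat -> R) (f : nat -> R) t :
  PSeries (fun n => theta a n * f n) t = t * PSeries (PS_derive (fun n => a n * f n)) t.
Proof.
rewrite PSeries_decr_1_aux by (unfold theta; simpl; ring).
f_equal. apply PSeries_ext. intro n. unfold PS_decr_1, PS_derive, theta. ring.
Qed.

Lemma ray_is_derive (a f : nat -> R) z r t : Cmod z < r -> abs_summable a r ->
  (forall n, Rabs (f n) <= Cmod z ^ n) -> 0 <= t <= 1 ->
  is_derive (PSeries (fun n => a n * f n)) t (PSeries (PS_derive (fun n => a n * f n)) t).
Proof.
intros Hz Ha Hf Ht. pose proof (Cmod_ge_0 z) as P.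
(* a radius [tau > 1] with [tau * |z| <= r] *)
set (d := (r - Cmod z) / (Cmod z + 1)).
assert (Hd : 0 < d) by (apply Rdiv_lt_0_compat; lra).
assert (Hd1 : d * (Cmod z + 1) = r - Cmod z) by (unfold d; field; lra).
apply is_derive_PSeries. apply abs_summable_CV_radius with (1 + d); [|rewrite Rabs_right; lra].
apply ex_series_le_R with (2 := Ha). intro n.
assert (H1 : 0 <= (1 + d) ^ n) by (apply pow_le; lra).
rewrite !Rabs_mult, !Rabs_Rabsolu, (Rabs_right ((1 + d) ^ n)) by lra.
rewrite Rmult_assoc. apply Rmult_le_compat_l; [apply Rabs_pos|].
apply Rle_trans with (Cmod z ^ n * (1 + d) ^ n).
- now apply Rmult_le_compat_r.
- rewrite <- Rpow_mult_distr. apply pow_incr. split; [apply Rmult_le_pos; lra|]. nra.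
Qed.

Lemma CP_at_0 a : CP a (RtoC 0) = RtoC (a 0%nat).
Proof. rewrite CP_real, PSeries_0. reflexivity. Qed.

(** [theta c = - c * theta l] says that [c exp l] has logarithmic derivative
    zero; integrate along the segment from 0 to [z]. *)
Lemma CP_mul_cexp c l z r : Cmod z < r -> abs_summable c r -> abs_summable l r ->
  c 0%nat = 1 -> l 0%nat = 0 -> theta c = (- (c * theta l))%S ->
  (CP c z * cexp (CP l z))%C = RtoC 1.
Proof.
intros Hz Hc Hl Hc0 Hl0 Hth. pose proof (Cmod_ge_0 z) as P.
assert (HfR : forall n, Rabs (Re (z ^ n)%C) <= Cmod z ^ n).
{ intro n. rewrite <- Cmod_pow. apply re_le_Cmod. }
assert (HfI : forall n, Rabs (Im (z ^ n)%C) <= Cmod z ^ n).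
{ intro n. rewrite <- Cmod_pow. apply Rabs_Im_le_Cmod. }
set (A1 := PSeries (fun n => c n * Re (z ^ n)%C)). set (A2 := PSeries (fun n => c n * Im (z ^ n)%C)).
set (B1 := PSeries (fun n => l n * Re (z ^ n)%C)). set (B2 := PSeries (fun n => l n * Im (z ^ n)%C)).
set (dA1 := PSeries (PS_derive (fun n => c n * Re (z ^ n)%C))).
set (dA2 := PSeries (PS_derive (fun n => c n * Im (z ^ n)%C))).
set (dB1 := PSeries (PS_derive (fun n => l n * Re (z ^ n)%C))).
set (dB2 := PSeries (PS_derive (fun n => l n * Im (z ^ n)%C))).
assert (HdA1 : forall t, 0 <= t <= 1 -> is_derive A1 t (dA1 t)) by (intros; now apply ray_is_derive with z r).
assert (HdA2 : forall t, 0 <= t <= 1 -> is_derive A2 t (dA2 t)) by (intros; now apply ray_is_derive with z r).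
assert (HdB1 : forall t, 0 <= t <= 1 -> is_derive B1 t (dB1 t)) by (intros; now apply ray_is_derive with z r).
assert (HdB2 : forall t, 0 <= t <= 1 -> is_derive B2 t (dB2 t)) by (intros; now apply ray_is_derive with z r).
assert (DA1 : forall t, 0 <= t <= 1 -> Derive (fun x : R => A1 x) t = dA1 t)
  by (intros; now apply is_derive_unique, HdA1).
assert (DA2 : forall t, 0 <= t <= 1 -> Derive (fun x : R => A2 x) t = dA2 t)
  by (intros; now apply is_derive_unique, HdA2).
assert (DB1 : forall t, 0 <= t <= 1 -> Derive (fun x : R => B1 x) t = dB1 t)
  by (intros; now apply is_derive_unique, HdB1).
assert (DB2 : forall t, 0 <= t <= 1 -> Derive (fun x : R => B2 x) t = dB2 t)
  by (intros; now apply is_derive_unique, HdB2).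
assert (Hode : forall t, 0 < t < 1 ->
  dA1 t = - (A1 t * dB1 t - A2 t * dB2 t) /\ dA2 t = - (A1 t * dB2 t + A2 t * dB1 t)).
{ intros t Ht.
  assert (Hm : Cmod (RtoC t * z)%C < r).
  { rewrite Cmod_mult, Cmod_R, Rabs_right by lra. nra. }
  pose proof (Cmod_ge_0 (RtoC t * z)%C).
  assert (E : CP (theta c) (RtoC t * z)%C
     = (- (CP c (RtoC t * z) * CP (theta l) (RtoC t * z)))%C).
  { rewrite Hth, CP_opp, CP_mul; [reflexivity| |].
    - apply abs_summable_le_r with r; [lra|assumption].
    - apply abs_summable_theta with r; [lra|assumption]. }
  rewrite !CP_ray, !PSeries_theta_ray in E. fold A1 A2 dA1 dA2 dB1 dB2 in E.
  assert (E1 := f_equal fst E). assert (E2 := f_equal snd E). simpl in E1, E2.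
  split; apply Rmult_eq_reg_l with t; lra. }
set (K1 := fun t => exp (B1 t) * (A1 t * cos (B2 t) - A2 t * sin (B2 t))).
set (K2 := fun t => exp (B1 t) * (A1 t * sin (B2 t) + A2 t * cos (B2 t))).
assert (HK1 : K1 1 = K1 0).
{ destruct (MVT_cor2 K1 (fun t => exp (B1 t) *
     (cos (B2 t) * (dA1 t + (A1 t * dB1 t - A2 t * dB2 t))
      - sin (B2 t) * (dA2 t + (A1 t * dB2 t + A2 t * dB1 t)))) 0 1 Rlt_0_1) as (t & Ht & Ht').
  - intros t Ht. apply is_derive_Reals. unfold K1. auto_derive.
    + repeat split; eexists; eauto.
    + rewrite DA1, DA2, DB1, DB2 by assumption. ring.
  - destruct (Hode t Ht') as [O1 O2]. rewrite O1, O2 in Ht. lra. }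
assert (HK2 : K2 1 = K2 0).
{ destruct (MVT_cor2 K2 (fun t => exp (B1 t) *
     (sin (B2 t) * (dA1 t + (A1 t * dB1 t - A2 t * dB2 t))
      + cos (B2 t) * (dA2 t + (A1 t * dB2 t + A2 t * dB1 t)))) 0 1 Rlt_0_1) as (t & Ht & Ht').
  - intros t Ht. apply is_derive_Reals. unfold K2. auto_derive.
    + repeat split; eexists; eauto.
    + rewrite DA1, DA2, DB1, DB2 by assumption. ring.
  - destruct (Hode t Ht') as [O1 O2]. rewrite O1, O2 in Ht. lra. }
assert (HK : forall t, (CP c (RtoC t * z) * cexp (CP l (RtoC t * z)))%C = (K1 t, K2 t)).
{ intro t. rewrite !CP_ray. fold A1 A2 B1 B2. apply C_eq; unfold K1, K2; simpl; ring. }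
replace z with (RtoC 1 * z)%C by ring. rewrite HK, HK1, HK2, <- HK.
replace (RtoC 0 * z)%C with (RtoC 0) by ring. rewrite !CP_at_0, Hc0, Hl0, cexp_0. ring.
Qed.

(** * Banach's fixed point theorem in the plane *)

Lemma C_fixed_point (T : C -> C) (q : R) : 0 <= q < 1 ->
  (forall x y, Cmod (T x - T y)%C <= q * Cmod (x - y)%C) -> exists x, T x = x.
Proof.
intros Hq HT. set (x := fun n => Nat.iter n T (RtoC 0)).
set (d := fun n => (x (S n) - x n)%C). set (D := Cmod (d 0%nat)).
assert (HD : 0 <= D) by apply Cmod_ge_0.
assert (Hd : forall n, Cmod (d n) <= q ^ n * D).
{ induction n as [|n IH]; [simpl; fold D; lra|].
  apply Rle_trans with (1 := HT (x (S n)) (x n)). fold (d n). simpl. nra. }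
assert (Hg : forall n, is_series (fun k => q ^ (n + k) * D) (q ^ n * D * / (1 - q))).
{ intro n. apply is_series_ext with (fun k => (q ^ n * D) * q ^ k).
  - intro k. rewrite pow_add. unfold scal; simpl; unfold mult; simpl. ring.
  - apply (is_series_scal (V := R_NormedModule)), is_series_geom. rewrite Rabs_right; lra. }
assert (Hs : forall n, C_abs_summable (fun k => d (n + k)%nat)).
{ intro n. apply ex_series_le_R with (2 := ex_intro _ _ (Hg n)). intro k.
  rewrite Rabs_right by (apply Rle_ge, Cmod_ge_0). apply Hd. }
set (y := (x 0%nat + CSeries d)%C).
assert (Hy : forall n, y = (x n + CSeries (fun k => d (n + k)%nat))%C).
{ induction n as [|n IH]; [reflexivity|]. rewrite IH, (CSeries_head _ (Hs n)).
  replace (n + 0)%nat with n by lia.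
  rewrite (CSeries_ext (fun k => d (n + S k)%nat) (fun k => d (S n + k)%nat))
    by (intro k; f_equal; lia).
  unfold d at 1. ring. }
assert (Hyn : forall n, Cmod (y - x n)%C <= q ^ n * (D * / (1 - q))).
{ intro n. rewrite (Hy n).
  replace (x n + CSeries (fun k => d (n + k)%nat) - x n)%C
    with (CSeries (fun k => d (n + k)%nat)) by ring.
  apply Rle_trans with (1 := Cmod_CSeries_le _ (Hs n)).
  rewrite <- Rmult_assoc, <- (is_series_unique _ _ (Hg n)).
  apply Series_le; [|eexists; apply Hg]. intro k. split; [apply Cmod_ge_0|apply Hd]. }
assert (Hq1 : 0 < / (1 - q)) by (apply Rinv_0_lt_compat; lra).
set (E := D * / (1 - q)) in *. assert (HE : 0 <= E) by (apply Rmult_le_pos; lra).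
assert (Hfix : forall n, Cmod (T y - y)%C <= 2 * E * q ^ n).
{ intro n. replace (T y - y)%C with ((T y - T (x n)) + - (y - x (S n)))%C
    by (change (x (S n)) with (T (x n)); ring).
  apply Rle_trans with (1 := Cmod_triangle _ _). rewrite Cmod_opp.
  assert (H1 := HT y (x n)). assert (H2 := Hyn n). assert (H3 := Hyn (S n)). simpl (q ^ S n) in H3.
  pose proof (Cmod_ge_0 (y - x n)%C).
  assert (0 <= q ^ n * E) by (apply Rmult_le_pos; [apply pow_le|]; lra). nra. }
exists y. destruct (Ceq_dec (T y) y) as [H|Hne]; [assumption|exfalso]. assert (Hp : 0 < Cmod (T y - y)%C).
{ apply Cmod_gt_0. intro H0. apply Hne. replace (T y) with (T y - y + y)%C by ring.
  rewrite H0. ring. }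
destruct (pow_lt_1_zero q ltac:(rewrite Rabs_right; lra) (Cmod (T y - y)%C / (2 * E + 1))) as [N HN].
{ apply Rdiv_lt_0_compat; lra. }
specialize (HN N (le_n N)). rewrite Rabs_right in HN by (apply Rle_ge, pow_le; lra).
apply Rlt_div_r in HN; [|lra]. specialize (Hfix N).
assert (0 <= q ^ N) by (apply pow_le; lra). nra.
Qed.

(** * Starlikeness *)

(** Banach's theorem is applied to a map of the whole plane; projecting on a left
    half plane makes it one without enlarging distances. *)
Definition half_plane_proj (m : R) (x : C) : C := (Rmin (fst x) m, snd x).

Lemma half_plane_proj_lipschitz m x y :
  Cmod (half_plane_proj m x - half_plane_proj m y)%C <= Cmod (x - y)%C.
Proof.
apply Rsqr_incr_0_var; [|apply Cmod_ge_0].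
rewrite !Rsqr_pow2, !Cmod2_alt. destruct x as [x1 x2], y as [y1 y2]. unfold Re, Im. simpl.
assert (H : Rabs (Rmin x1 m + - Rmin y1 m) <= Rabs (x1 + - y1)).
{ unfold Rmin. destruct (Rle_dec x1 m), (Rle_dec y1 m); unfold Rabs;
    repeat match goal with |- context [Rcase_abs ?u] => destruct (Rcase_abs u) end; lra. }
apply Rsqr_le_abs_1 in H. unfold Rsqr in H. lra.
Qed.

(** As [L] has nonnegative coefficients, its derivative in [x = log z] is largest in
    modulus on the positive axis, where it equals [theta L]. *)
Lemma CP_cexp_contraction l x y rho : 0 < rho -> (forall n, 0 <= theta l n) ->
  abs_summable l rho -> abs_summable (theta l) rho -> Re x <= ln rho -> Re y <= ln rho ->
  Cmod (CP l (cexp x) - CP l (cexp y))%C <= PSeries (theta l) rho * Cmod (x - y)%C.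
Proof.
intros Hr Hp Hl Ht Hx Hy.
assert (Hm : forall u, Re u <= ln rho -> Cmod (cexp u) <= rho).
{ intros u Hu. rewrite Cmod_cexp, <- (exp_ln rho) by assumption.
  destruct Hu as [Hu| ->]; [left; now apply exp_increasing|].
  rewrite exp_ln by assumption. apply Rle_refl. }
apply Rle_trans with (1 := CP_lipschitz l _ _ rho Hr (Hm x Hx) (Hm y Hy) Hl Ht).
assert (E : Series (fun n => Rabs (theta l n) * rho ^ n) = PSeries (theta l) rho).
{ apply Series_ext. intro n. rewrite Rabs_right; [reflexivity|]. now apply Rle_ge. }
rewrite E. apply Rmult_le_compat_l.
- rewrite <- E. rewrite <- (Series_zero (fun _ => 0)) by reflexivity. apply Series_le; [|exact Ht].
  intro n. split; [lra|]. apply Rmult_le_pos; [apply Rabs_pos|apply pow_le; lra].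
- apply Rle_div_l; [assumption|]. rewrite Rmult_comm. now apply cexp_lipschitz.
Qed.

(** With [x = log z] the function is [exp (x - L (e^x))], and [L (e^x)] is a contraction
    on each half plane [Re x <= ln rho < 0]. Two points with the same value have,
    on suitable sheets of the logarithm, the same [x - L (e^x)] and therefore coincide.
    For the segment from 0 to [f z] one solves
    [y - L (e^y) = x - L z + ln t] in the half plane [Re y <= Re x]. *)
Lemma starlike_of_contraction (f : C -> C) (l : nat -> R) : analytic_disk f ->
  (forall n, 0 <= theta l n) ->
  (forall rho, 0 < rho < 1 -> abs_summable l rho) ->
  (forall rho, 0 < rho < 1 -> abs_summable (theta l) rho) ->
  (forall rho, 0 < rho < 1 -> PSeries (theta l) rho < 1) ->
  (forall z, disk z -> f z = (z * cexp (- CP l z))%C) ->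
  starlike f.
Proof.
intros Han Hp Hl Ht Hq Hf.
assert (Hq0 : forall rho, 0 < rho < 1 -> 0 <= PSeries (theta l) rho).
{ intros rho Hr. rewrite <- (Series_zero (fun _ => 0)) by reflexivity.
  apply Series_le.
  - intro n. split; [lra|]. apply Rmult_le_pos; [apply Hp|apply pow_le; lra].
  - apply ex_series_ext_R with (2 := Ht rho Hr). intro n.
    rewrite Rabs_right; [reflexivity|]. now apply Rle_ge. }
assert (Hexp : forall x, Re x < 0 -> f (cexp x) = cexp (x - CP l (cexp x))%C).
{ intros x Hx. rewrite Hf.
  - unfold Cminus. now rewrite cexp_plus.
  - unfold disk. rewrite Cmod_cexp, <- exp_0. now apply exp_increasing. }
assert (Hlog : forall z, disk z -> z <> RtoC 0 ->
  0 < Cmod z < 1 /\ ln (Cmod z) < 0).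
{ intros z Hz Hz0. assert (0 < Cmod z) by now apply Cmod_gt_0. unfold disk in Hz.
  split; [lra|]. rewrite <- ln_1. now apply ln_increasing. }
assert (Hf0 : forall z, disk z -> f z = RtoC 0 -> z = RtoC 0).
{ intros z Hz E. rewrite Hf in E by assumption.
  replace z with ((z * cexp (- CP l z)) * cexp (- - CP l z))%C.
  - rewrite E. ring.
  - rewrite <- Cmult_assoc, cexp_opp. ring. }
assert (Hf00 : f (RtoC 0) = RtoC 0) by (rewrite Hf; [ring|unfold disk; rewrite Cmod_0; lra]).
split; [split; [assumption|]|].
- intros z1 z2 Hz1 Hz2 E.
  destruct (Ceq_dec z1 0%C) as [E1|E1].
  { subst z1. symmetry. apply Hf0; [assumption|]. now rewrite <- E. }
  destruct (Ceq_dec z2 0%C) as [E2|E2].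
  { subst z2. apply Hf0; [assumption|]. now rewrite E. }
  destruct (Hlog z1 Hz1 E1) as [M1 L1]. destruct (Hlog z2 Hz2 E2) as [M2 L2].
  destruct (clog_exists z1 E1) as (x1 & X1 & R1). destruct (clog_exists z2 E2) as (x2 & X2 & R2).
  rewrite <- X1, <- X2, !Hexp in E by lra.
  destruct (cexp_eq _ _ E) as (p & Hp1 & Hx).
  (* replace [x2] by the logarithm of [z2] on the right sheet *)
  set (y := (x2 + p)%C).
  assert (Y : cexp y = z2) by (unfold y; rewrite cexp_plus, Hp1, X2; ring).
  assert (RY : Re y = ln (Cmod z2)).
  { rewrite <- Y, Cmod_cexp, ln_exp. reflexivity. }
  set (rho := Rmax (Cmod z1) (Cmod z2)).
  assert (Hrho : 0 < rho < 1).
  { split; [apply Rlt_le_trans with (2 := Rmax_l _ _); lra|now apply Rmax_lub_lt]. }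
  assert (Hln : forall u, 0 < u -> u <= rho -> ln u <= ln rho).
  { intros u Hu [H| ->]; [left; now apply ln_increasing|apply Rle_refl]. }
  assert (C1 := CP_cexp_contraction l x1 y rho (proj1 Hrho) Hp (Hl rho Hrho) (Ht rho Hrho)).
  rewrite R1, RY in C1.
  specialize (C1 (Hln _ (proj1 M1) (Rmax_l _ _)) (Hln _ (proj1 M2) (Rmax_r _ _))).
  rewrite X1, Y in C1. rewrite X1, X2 in Hx.
  replace (CP l z1 - CP l z2)%C with (x1 - y)%C in C1.
  + assert (H0 : Cmod (x1 - y)%C = 0).
    { pose proof (Cmod_ge_0 (x1 - y)%C). specialize (Hq rho Hrho). nra. }
    apply Cmod_eq_0 in H0. rewrite <- X1, <- Y. f_equal.
    replace x1 with (x1 - y + y)%C by ring. rewrite H0. ring.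
  + replace x1 with (x1 - CP l z1 + CP l z1)%C by ring. rewrite Hx. unfold y. ring.
- intros p t (z & Hz & <-) Ht01.
  destruct (Ceq_dec z 0%C) as [E0|E0].
  { exists (RtoC 0). split; [unfold disk; rewrite Cmod_0; lra|]. rewrite E0, Hf00. ring. }
  destruct (Req_dec t 0) as [Et|Et].
  { exists (RtoC 0). split; [unfold disk; rewrite Cmod_0; lra|]. rewrite Et, Hf00. ring. }
  assert (Hlt : ln t <= 0).
  { rewrite <- ln_1. destruct (proj2 Ht01) as [H| ->]; [left; apply ln_increasing; lra|apply Rle_refl]. }
  destruct (Hlog z Hz E0) as [M L]. destruct (clog_exists z E0) as (x & X & RX).
  set (m := ln (Cmod z)) in *. set (q := PSeries (theta l) (Cmod z)).
  assert (Hctr : forall u v, Re u <= m -> Re v <= m ->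
    Cmod (CP l (cexp u) - CP l (cexp v))%C <= q * Cmod (u - v)%C).
  { intros u v Hu Hv. apply CP_cexp_contraction; auto. apply M. }
  assert (HPm : forall u, Re (half_plane_proj m u) <= m) by (intro u; apply Rmin_r).
  set (G := fun u => (x + RtoC (ln t) - CP l z + CP l (cexp u))%C).
  destruct (C_fixed_point (fun u => half_plane_proj m (G (half_plane_proj m u))) q) as [y Hy].
  { split; [now apply Hq0|now apply Hq]. }
  { intros u v. apply Rle_trans with (1 := half_plane_proj_lipschitz _ _ _).
    replace (G (half_plane_proj m u) - G (half_plane_proj m v))%C
      with (CP l (cexp (half_plane_proj m u)) - CP l (cexp (half_plane_proj m v)))%C
      by (unfold G; ring).
    apply Rle_trans with (1 := Hctr _ _ (HPm u) (HPm v)).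
    apply Rmult_le_compat_l; [now apply Hq0|apply half_plane_proj_lipschitz]. }
  cbv beta in Hy.
  assert (Hym : Re y <= m) by (rewrite <- Hy; apply HPm).
  assert (Hproj : forall u, Re u <= m -> half_plane_proj m u = u).
  { intros [u1 u2] Hu. unfold half_plane_proj; simpl in *. now rewrite Rmin_left. }
  rewrite (Hproj y Hym) in Hy.
  (* The projection is inactive at the fixed point: otherwise [y] would lie on the
     boundary line through [x], hence coincide with [x] by contraction. *)
  assert (Hg : Re (G y) <= m).
  { apply Rnot_lt_le. intro Hgt.
    assert (Hyx : y = x).
    { assert (Dyx : (y - x)%C = (0, Im (CP l (cexp y) - CP l (cexp x))%C)).
      { rewrite X. apply C_eq.
        - rewrite <- Hy. unfold half_plane_proj, Re in *. simpl in *. rewrite Rmin_right by lra. lra.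
        - rewrite <- Hy at 1. unfold half_plane_proj, G, Im. simpl. ring. }
      assert (Hle : Cmod (y - x)%C <= Cmod (CP l (cexp y) - CP l (cexp x))%C).
      { rewrite Dyx at 1. set (s := Im _). 
        replace (Cmod (0, s)) with (Rabs s); [apply Rabs_Im_le_Cmod|].
        rewrite <- sqrt_Rsqr_abs. unfold Cmod. simpl. f_equal. unfold Rsqr. ring. }
      assert (H1 := Hctr y x Hym ltac:(rewrite RX; apply Rle_refl)).
      assert (H0 : Cmod (y - x)%C = 0).
      { pose proof (Cmod_ge_0 (y - x)%C). assert (H2 := Hq (Cmod z) M). fold q in H2. nra. }
      apply Cmod_eq_0 in H0. replace y with (y - x + x)%C by ring. rewrite H0. ring. }
    rewrite Hyx in Hgt. unfold G in Hgt. rewrite X in Hgt.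
    replace (x + RtoC (ln t) - CP l z + CP l z)%C with (x + RtoC (ln t))%C in Hgt by ring.
    unfold Re in *. simpl in Hgt. lra. }
  rewrite (Hproj _ Hg) in Hy.
  exists (cexp y). split.
  + unfold disk. rewrite Cmod_cexp, <- exp_0. apply exp_increasing. lra.
  + rewrite Hexp by lra. rewrite <- X at 1. rewrite Hexp by lra. rewrite X.
    rewrite <- (exp_ln t) at 1 by lra. rewrite <- cexp_R, <- cexp_plus. f_equal.
    rewrite <- Hy at 1. unfold G. ring.
Qed.

Lemma PSeries_w'_eq a nu x : 0 < a -> - (3 / 4) < nu ->
  w_real' a nu x = PSeries (w_coef a nu) x + PSeries (theta (w_coef a nu)) x.
Proof.
intros Ha Hn. assert (He := entire_w_coef a nu Ha Hn).
unfold w_real'. rewrite <- PSeries_plus.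
- apply PSeries_ext. intro n. unfold w_derive_coef, PS_derive_n, PS_plus, theta, plus; simpl.
  replace (n + 1)%nat with (S n) by lia. rewrite fact_simpl, mult_INR, S_INR. simpl PS_incr_1.
  field. apply INR_fact_neq_0.
- now apply CV_radius_inside, entire_CV_radius.
- now apply CV_radius_inside, entire_CV_radius, entire_theta.
Qed.

(** The function [L = - log phi], with [z L' = s]. At index 0 the quotient is 0 because
    [w_logder] vanishes there. *)
Definition w_log (a nu : R) (n : nat) : R := w_logder a nu n / INR n.

Lemma theta_w_log a nu : theta (w_log a nu) = w_logder a nu.
Proof.
apply functional_extensionality. intros [|n].
- rewrite w_logder_0. unfold theta. simpl. ring.
- unfold theta, w_log. field. apply not_0_INR. lia.
Qed.

Lemma abs_summable_linear_growth b r : 0 <= r < 1 ->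
  (forall n, Rabs (b n) <= INR (S n)) -> abs_summable b r.
Proof.
intros Hr Hb. set (r' := (r + 1) / 2).
assert (Hg : ex_series (fun n => r' ^ n)).
{ eexists. apply is_series_geom. unfold r'. rewrite Rabs_right; lra. }
assert (H1 : abs_summable (fun _ => 1) r').
{ apply ex_series_ext_R with (2 := Hg). intro n. rewrite Rabs_R1. ring. }
assert (H : Rbar_lt (Rabs r) (CV_radius (PS_derive (fun _ => 1)))).
{ rewrite CV_radius_derive. apply abs_summable_CV_radius with r'; [assumption|].
  unfold r'. rewrite Rabs_right; lra. }
apply CV_disk_inside in H. apply ex_series_le_R with (2 := H). intro n.
assert (0 <= r ^ n) by (apply pow_le; lra).
unfold PS_derive. rewrite Rmult_1_r, !Rabs_mult, Rabs_Rabsolu.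
apply Rmult_le_compat_r; [apply Rabs_pos|]. rewrite (Rabs_right (INR (S n))); [apply Hb|].
apply Rle_ge, pos_INR.
Qed.

(** On the positive axis [w' = phi (1 - s)] is positive, being decreasing with
    [w'(1) >= 0]; hence [s < 1] there. *)
Lemma starlike_w a nu : 0 < a -> - (3 / 4) < nu -> 2 / a + 1 <= 4 * (nu + 1) ->
  0 <= w_real' a nu 1 -> starlike (w a nu).
Proof.
intros Ha Hn Han Hw1.
assert (Hs := w_logder_bounds a nu Ha ltac:(lra) Han).
assert (He := entire_w_coef a nu Ha Hn).
assert (Hl0 : w_log a nu 0 = 0) by (unfold w_log; rewrite w_logder_0; unfold Rdiv; ring).
assert (Hs1 : forall r, 0 <= r < 1 -> abs_summable (w_logder a nu) r).
{ intros r Hr. apply abs_summable_linear_growth; [assumption|]. intro n.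
  rewrite Rabs_right by (apply Rle_ge, Hs). apply Hs. }
assert (Hs2 : forall r, 0 <= r < 1 -> abs_summable (w_log a nu) r).
{ intros r Hr. apply abs_summable_linear_growth; [assumption|].
  intros [|n]; [rewrite Hl0, Rabs_R0; apply pos_INR|].
  assert (1 <= INR (S n)) by (rewrite S_INR; pose proof (pos_INR n); lra).
  unfold w_log. rewrite Rabs_right.
  - apply Rle_trans with (2 := proj2 (Hs (S n))). apply Rle_div_l; [lra|].
    assert (0 <= w_logder a nu (S n)) by apply Hs. nra.
  - apply Rle_ge. apply Rmult_le_pos; [apply Hs|]. apply Rlt_le, Rinv_0_lt_compat; lra. }
assert (Hexp : forall z, disk z -> (CP (w_coef a nu) z * cexp (CP (w_log a nu) z))%C = RtoC 1).
{ intros z Hz. unfold disk in Hz. pose proof (Cmod_ge_0 z).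
  apply CP_mul_cexp with ((Cmod z + 1) / 2).
  - lra.
  - apply He. lra.
  - apply Hs2. lra.
  - apply w_coef_0; lra.
  - exact Hl0.
  - rewrite theta_w_log. apply theta_w_coef; lra. }
apply starlike_of_contraction with (w_log a nu).
- rewrite w_eq_CP. now apply analytic_CP, entire_incr.
- rewrite theta_w_log. apply Hs.
- intros r Hr. apply Hs2. lra.
- intros r Hr. rewrite theta_w_log. apply Hs1. lra.
- intros r Hr. rewrite theta_w_log.
  assert (Hc : 0 < PSeries (w_coef a nu) r).
  { assert (H := Hexp (RtoC r) ltac:(unfold disk; rewrite Cmod_R, Rabs_right; lra)).
    rewrite !CP_real, cexp_R, <- RtoC_mult in H. apply RtoC_inj in H.
    assert (P := exp_pos (PSeries (w_log a nu) r)).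
    apply Rmult_lt_reg_r with (1 := P). lra. }
  assert (Hm : PSeries (theta (w_coef a nu)) r
     = - (PSeries (w_coef a nu) r * PSeries (w_logder a nu) r)).
  { rewrite theta_w_coef by lra.
    rewrite <- PSeries_mult.
    - apply PSeries_opp.
    - now apply entire_CV_radius.
    - apply abs_summable_CV_radius with ((r + 1) / 2); [apply Hs1|rewrite Rabs_right]; lra. }
  assert (Hd := w_real'_decreasing a nu r 1 Ha Hn ltac:(lra) ltac:(lra) ltac:(lra)).
  rewrite (PSeries_w'_eq a nu r Ha Hn), Hm in Hd. nra.
- intros z Hz. rewrite w_eq_mul by assumption. f_equal.
  assert (H := Hexp z Hz).
  replace (CP (w_coef a nu) z) with
    (CP (w_coef a nu) z * (cexp (CP (w_log a nu) z) * cexp (- CP (w_log a nu) z)))%C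
    by (rewrite cexp_opp; ring).
  rewrite Cmult_assoc, H. ring.
Qed.

Theorem theorem3 (nu a : R) (Hnu : - (3 / 4) < nu) (Ha : 2 / (4 * nu + 3) <= a) :
  (forall x : R, 0 < x < 1 ->
     w a nu (RtoC x) =
     RtoC (Rpower 2 nu / a * Gamma (nu + 1) * Rpower x (1 - nu / 2)
           * ((a - nu) * BesselJ nu (sqrt x)
              + sqrt x * Derive (BesselJ nu) (sqrt x))))
  /\
  exists nu_a : R,
    unique (fun mu : R => - (3 / 4) < mu /\ nu_equation a mu) nu_a /\
    ((starlike (w a nu) /\
      forall k : nat, (1 <= k)%nat -> close_to_convex (C_derive_n (w a nu) k))
     <-> nu_a <= nu) /\
    (nu_a <= nu -> forall k : nat, (1 <= k)%nat -> univalent (C_derive_n (w a nu) k)).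
Proof.
assert (Ha0 : 0 < a).
{ apply Rlt_le_trans with (2 := Ha). apply Rdiv_lt_0_compat; lra. }
assert (Han : 2 / a + 1 <= 4 * (nu + 1)).
{ assert (2 / a <= 4 * nu + 3); [|lra]. apply Rle_div_l in Ha; [|lra].
  apply Rle_div_l; lra. }
split.
{ intros x Hx. apply w_eq_Dini; lra. }
destruct (unique_nu_a a Ha0) as (nu_a & [Hmu Heq] & Huniq).
exists nu_a. split; [split; [split|]; assumption|].
apply nu_equation_iff in Heq; try assumption.
split; [split|].
- intros [[Hu _] _]. apply Rnot_lt_le. intro Hlt.
  assert (H1 := w_real'_1_increasing a nu nu_a Ha0 Hnu Hlt).
  assert (H2 := univalent_w_real' a nu Ha0 Hnu Hu). lra.
- intro Hle. split.
  + apply starlike_w; try assumption.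
    destruct Hle as [Hlt| <-]; [|lra].
    assert (H1 := w_real'_1_increasing a nu_a nu Ha0 Hmu Hlt). lra.
  + intros k Hk. now apply close_to_convex_derivatives.
- intros _ k Hk. now apply univalent_derivatives.
Qed.
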